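(* Let $\Phi=(\varphi_i)_{i\in\mathcal I}$ be a conformal iterated function system on $\mathbb C$ (that is, with $d=2$, on a bounded domain $\Omega\subset\mathbb C$). If $\sup_{x\in\overline\Omega}|T_{\mathtt i}(x)-T_{\mathtt j}(x)|>0$ for all distinct $\mathtt i,\mathtt j\in\mathcal I^{\mathbb N}\cup\mathcal I^*$ with $|\mathtt i|=|\mathtt j|$, then $\Phi$ satisfies the strong exponential separation condition modulo similarities.
   Context: Conformal iterated function system ($d=2$): $\mathcal I=\{1,\dots,N\}$ with $N\ge2$; $\Omega\subset\mathbb C$ is a bounded nonempty connected open set; $\Phi=(\varphi_i)_{i\in\mathcal I}$ is a tuple of maps with $\varphi_i(\overline\Omega)\subset\Omega$ that extend to holomorphic maps with nonvanishing derivative on a connected open set $\Omega'\supset\overline\Omega$ and satisfy $|\varphi_i'|<1$ on $\overline\Omega$. Words: $\mathcal I^*$ are the finite words (including the empty word), $\mathcal I^n$ those of length $n$, $\mathcal I^{\mathbb N}$ the infinite words, $|\mathtt i|$ the length (possibly $\infty$), $\mathtt i|_n$ the length-$n$ prefix. For $\mathtt i=i_1\cdots i_n$ put $\varphi_{\mathtt i}=\varphi_{i_1}\circ\cdots\circ\varphi_{i_n}$ and $f_{\mathtt i}=\varphi_{i_n}\circ\cdots\circ\varphi_{i_1}$ (identity for the empty word). For finite $\mathtt i$, $T_{\mathtt i}=f_{\mathtt i}''/f_{\mathtt i}'$; for infinite $\mathtt i$, $T_{\mathtt i}$ is the uniform limit on $\overline\Omega$ of $T_{\mathtt i|_n}$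 (which exists). Strong exponential separation condition modulo similarities: there is $c>0$ such that $\sup_{x\in\overline\Omega}|\varphi_{\mathtt i}(x)-A(\varphi_{\mathtt j}(x))|\ge c^n$ for every $n\in\mathbb N$, all distinct $\mathtt i,\mathtt j\in\mathcal I^n$ and every similarity $A$ of $\mathbb C$, that is, every map $z\mapsto az+b$ or $z\mapsto a\overline z+b$ with $a,b\in\mathbb C$, $a\ne0$. *)

(* Defs.v *)
From HB Require Import structures.
From mathcomp Require Import all_boot all_order all_algebra.
From mathcomp Require Import all_classical all_reals all_analysis.
From mathcomp Require Import complex.
Import numFieldNormedType.Exports.
Import Order.TTheory GRing.Theory Num.Theory.

Set Implicit Arguments.
Unset Strict Implicit.
Unset Printing Implicit Defensive.

Local Open Scope classical_set_scope.
Local Open Scope ring_scope.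

(* R[i]^o is R[i] as a normed space over itself, so that derivable f z 1 and
   'D_1 f z are complex differentiability and the complex derivative. *)
Notation cplx R := ((complex (Real.sort R))^o).

Section Defs.
Variable R : realType.
Local Notation C := (cplx R).

Definition cabs (z : C) : R := Normc.normc z.

(* The maps are represented by (arbitrary total prolongations of) their
   holomorphic extensions to Omega'; since Omega' is an open neighbourhood of
   the closure of Omega, derivatives on the closure do not depend on the values
   outside Omega'. *)
Record conformal_ifs (N : nat) (Omega : set C) (phi : 'I_N -> C -> C) : Prop := {
  cifs_card : (2 <= N)%N ;
  cifs_bounded : bounded_set Omega ;
  cifs_nonempty : Omega !=set0 ;
  cifs_connected : connected Omega ;
  cifs_open : open Omega ;
  cifs_maps : forall k, phi k @` closure Omega `<=` Omega ;
  cifs_holomorphic : exists Omega' : set C,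
    [/\ open Omega', connected Omega', closure Omega `<=` Omega' &
      forall k z, Omega' z -> derivable (phi k) z 1 /\ 'D_1 (phi k) z != 0] ;
  cifs_contracting : forall k z, closure Omega z -> cabs ('D_1 (phi k) z) < 1
}.

Section Words.
Variables (N : nat) (Omega : set C) (phi : 'I_N -> C -> C).

(* phi_{i_1} \o ... \o phi_{i_n} *)
Definition phi_word (w : seq 'I_N) : C -> C :=
  foldr (fun k g => phi k \o g) id w.

(* phi_{i_n} \o ... \o phi_{i_1} *)
Definition f_word (w : seq 'I_N) : C -> C :=
  foldr (fun k g => g \o phi k) id w.

Variant word := FinWord of seq 'I_N | InfWord of (nat -> 'I_N).

(* None stands for infinite length. *)
Definition word_length (w : word) : option nat :=
  match w with FinWord s => Some (size s) | InfWord _ => None end.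

Definition T_fin (w : seq 'I_N) : C -> C :=
  fun z => 'D_1 ('D_1 (f_word w)) z / 'D_1 (f_word w) z.

(* The uniform limit on the closure of Omega of the T of the finite prefixes;
   only its values on that closure are determined. *)
Definition T_inf (w : nat -> 'I_N) : C -> C :=
  get (fun t : C -> C =>
    {uniform closure Omega, (fun n => T_fin (mkseq w n)) @ \oo --> t}).

Definition T_word (w : word) : C -> C :=
  match w with FinWord s => T_fin s | InfWord u => T_inf u end.

Definition similarity (A : C -> C) : Prop :=
  exists a b : C, a != 0 /\
    ((forall z, A z = a * z + b) \/ (forall z, A z = a * conjc z + b)).

Definition strong_exp_separation_mod_similarities : Prop :=
  exists2 c : R, 0 < c &
    forall (n : nat) (i j : n.-tuple 'I_N), i != j ->
    forall A : C -> C, similarity A ->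
      c ^+ n <= sup [set cabs (phi_word i x - A (phi_word j x))
                    | x in closure Omega].

End Words.
End Defs.

(* Main.v *)
Require Import Defs.
From HB Require Import structures.
From mathcomp Require Import all_boot all_order all_algebra.
From mathcomp Require Import all_classical all_reals all_analysis.
From mathcomp Require Import complex ring lra.
Import numFieldNormedType.Exports.
Import Order.TTheory GRing.Theory Num.Theory.
Set Implicit Arguments.
Unset Strict Implicit.
Unset Printing Implicit Defensive.
Local Open Scope classical_set_scope.
Local Open Scope ring_scope.
Local Open Scope complex_scope.
Local Notation re := complex.Re.
Local Notation im := complex.Im.

(** T_w = f_w'' / f_w' is unchanged when f_w is composed on the left with an
    affine map. Hence, if a similarity A brings phi_i within e of A o phi_j,
    Cauchy estimates force T_(rev i) - T_(rev j) = O(e / kappa^n) when A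
    preserves orientation, kappa being a lower bound of the |phi_k'|; when A
    reverses it, phi_i is holomorphic and close to an antiholomorphic map, so
    its derivative is O(e), whereas it is at least kappa^n.

    If u is the longest common prefix of two words u s and u t, then
    T_(u s) - T_(u t) = ((T_s - T_t) o f_u) f_u'. The space of finite and
    infinite words is compact, and T_s - T_t does not vanish identically on
    Omega when s and t have different first letters; by the identity theorem,
    some derivative of T_s - T_t of order at most D, with D independent of s
    and t, is bounded below at each point of the images of the phi_k. Cauchy
    estimates and the chain rule bring this lower bound back through f_u at
    the price of a factor kappa^((D + 1) n). *)

(** * Complex modulus and complex derivatives *)

(** For an infinite word W, T_W is determined only on the closure of Omega and known to be
    holomorphic only inside, so its derivatives are bounded uniformly only at points keeping a fixed
    distance from the boundary. The points phi_k(z) with z in the closure do; hence the lower bound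
    is stated there, and the base point of the final estimate is itself such an image: f_u of it is
    again one, even for empty u.

    The separation hypothesis compares only words of equal length, so equality of lengths has to
    survive the passage to a limit of pairs of words.

    The loss kappa^((D + 1) n), a further kappa^n from dividing by f_i', and the constant factors
    are absorbed into c^n, as distinct words of equal length n force n >= 1.

    The complex analysis uses neither power series nor an integral formula. It rests on one
    consequence of Goursat's theorem: |f(z0)| <= M if |f| <= M on a circle around z0. Applied to a
    difference quotient it yields the Cauchy estimates, applied to g / (z - y)^n the identity
    theorem. *)

Section ComplexModulus.
Variable R : realType.
Local Notation C := (cplx R).
Implicit Types (x y z : C) (a r : R).

Lemma cabs_ge0 z : 0 <= cabs z.
Proof. by case: z => a b; rewrite sqrtr_ge0. Qed.

Lemma cabs0 : cabs (0 : C) = 0.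
Proof. exact: Normc.normc0. Qed.

Lemma cabs_eq0 z : (cabs z == 0) = (z == 0).
Proof.
by apply/eqP/eqP => [/Normc.eq0_normc//|->]; exact: cabs0.
Qed.

Lemma cabs_gt0 z : (0 < cabs z) = (z != 0).
Proof. by rewrite lt_def cabs_ge0 andbT cabs_eq0. Qed.

Lemma cabsM x y : cabs (x * y) = cabs x * cabs y.
Proof. exact: Normc.normcM. Qed.

Lemma cabsV x : cabs x^-1 = (cabs x)^-1.
Proof. exact: Normc.normcV. Qed.

Lemma cabs1 : cabs (1 : C) = 1.
Proof. exact: Normc.normc1. Qed.

Lemma cabsX x n : cabs (x ^+ n) = cabs x ^+ n.
Proof.
by elim: n => [|n IH]; rewrite ?expr0 ?cabs1// !exprS cabsM IH.
Qed.

Lemma cabsN x : cabs (- x) = cabs x.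
Proof. exact: normcN. Qed.

Lemma cabsC x y : cabs (x - y) = cabs (y - x).
Proof. by rewrite -cabsN opprB. Qed.

Lemma cabsD x y : cabs (x + y) <= cabs x + cabs y.
Proof. exact: le_normcD. Qed.

Lemma cabsB x y : cabs (x - y) <= cabs x + cabs y.
Proof. by rewrite -(cabsN y); exact: cabsD. Qed.

Lemma cabs_dist y x z : cabs (x - z) <= cabs (x - y) + cabs (y - z).
Proof. by rewrite (_ : x - z = (x - y) + (y - z)) ?cabsD//; ring. Qed.

Lemma cabs_real a : cabs (a%:C : C) = `|a|.
Proof. by rewrite /cabs /= expr0n /= addr0 sqrtr_sqr. Qed.

Lemma cabs_conj z : cabs (conjc z : C) = cabs z.
Proof. by case: z => a b; rewrite /cabs /= sqrrN. Qed.

Lemma Re_cabs z : `|re z| <= cabs z.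
Proof.
case: z => a b; rewrite /cabs /= -sqrtr_sqr ler_sqrt ?lerDl ?sqr_ge0//.
by rewrite addr_ge0 ?sqr_ge0.
Qed.

Lemma Im_cabs z : `|im z| <= cabs z.
Proof.
case: z => a b; rewrite /cabs /= -sqrtr_sqr ler_sqrt ?lerDr ?sqr_ge0//.
by rewrite addr_ge0 ?sqr_ge0.
Qed.

Lemma cabs_ReIm z : cabs z <= `|re z| + `|im z|.
Proof.
rewrite [in leLHS](complexE z); apply: le_trans (cabsD _ _) _.
rewrite cabsM !cabs_real [cabs 'i](_ : _ = 1) ?mul1r//.
by rewrite /cabs/= expr0n expr1n add0r sqrtr1.
Qed.

Lemma cabs_normE z : `|z| = (cabs z)%:C.
Proof. by case: z. Qed.

Lemma sqr_cabs z : (cabs z ^+ 2)%:C = conjc z * z :> C.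
Proof.
case: z => a b; rewrite /cabs /= sqr_sqrtr ?addr_ge0 ?sqr_ge0//.
by apply/eqP; rewrite eq_complex /=; apply/andP; split; apply/eqP; ring.
Qed.

Lemma ReD x y : re (x + y) = re x + re y.
Proof. by case: x; case: y. Qed.

Lemma ReB x y : re (x - y) = re x - re y.
Proof. by case: x; case: y. Qed.

Lemma ImB x y : im (x - y) = im x - im y.
Proof. by case: x; case: y. Qed.

Lemma ReZ a x : re (a%:C * x) = a * re x.
Proof. by case: x => b c /=; rewrite mul0r subr0. Qed.

End ComplexModulus.

(** * Topology of C in terms of the real modulus *)

Section Bridges.
Variable R : realType.
Local Notation C := (cplx R).
Implicit Types (x y z : C) (a r : R).

(** The norm of C has values in C, so radii are complex numbers that positivity forces to be real;
    passing to real parts gives discs of real radius. *)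
Lemma nbhs_cabsP z (A : set C) :
  nbhs z A <-> exists2 d : R, 0 < d & forall w, cabs (w - z) < d -> A w.
Proof.
split.
  move=> /(iffLR (nbhs_normP _ _))[d /= d0 dA]; have dE : d = (re d)%:C.
    by rewrite RRe_real// gtr0_real.
  exists (re d); first by rewrite -ltcR -dE.
  by move=> w wz; apply: dA; rewrite /= dE distrC cabs_normE ltcR.
move=> [d d0 dA]; apply: (iffRL (@nbhs_normP _ C z A)).
exists d%:C; first by rewrite /= ltcR.
by move=> w /=; rewrite distrC cabs_normE ltcR; exact: dA.
Qed.

Lemma open_cabsP (A : set C) : open A <->
  forall z, A z -> exists2 d : R, 0 < d & forall w, cabs (w - z) < d -> A w.
Proof.
rewrite openE; split=> oA z Az; first exact/nbhs_cabsP/oA.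
exact/nbhs_cabsP/oA.
Qed.

Lemma closure_cabsP (A : set C) z : closure A z <->
  forall d : R, 0 < d -> exists2 w, A w & cabs (w - z) < d.
Proof.
split=> [cA d d0|cA B /nbhs_cabsP[d d0 dB]].
  have : nbhs z [set w : C | cabs (w - z) < d] by apply/nbhs_cabsP; exists d.
  by move=> /cA[w [Aw wz]]; exists w.
by have [w Aw wz] := cA d d0; exists w; split => //; exact: dB.
Qed.

Lemma bounded_cabs (A : set C) :
  bounded_set A -> exists M : R, forall z, A z -> cabs z <= M.
Proof.
move=> /ex_strict_bound_gt0[M _ MA]; exists (re M) => z /MA /=.
by rewrite cabs_normE ltcE => /andP[_ /ltW].
Qed.

End Bridges.

(** * Complex derivatives in epsilon-delta form *)

Section Derivatives.
Variable R : realType.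
Local Notation C := (cplx R).
Implicit Types (f g : C -> C) (x y z : C) (a r : R).

(** The difference quotient is multiplied out: w = z needs no exception, and estimates combine
    linearly without division. *)
Definition has_cderiv f z (d : C) : Prop := forall e : R, 0 < e ->
  exists2 r : R, 0 < r & forall w, cabs (w - z) < r ->
    cabs (f w - f z - d * (w - z)) <= e * cabs (w - z).

Lemma is_derive_has_cderiv f z d : is_derive z 1 f d <-> has_cderiv f z d.
Proof.
split=> [[df dE] e e0|fd].
  have : nbhs d [set w : C | cabs (w - d) < e] by apply/nbhs_cabsP; exists e.
  rewrite -dE => /df /nbhs_cabsP[r r0 rP]; exists r => // w wz.
  have [->|wz0] := eqVneq w z; first by rewrite !subrr mulr0 subr0 cabs0 mulr0.
  have := rP (w - z); rewrite subr0 => /(_ wz); rewrite subr_eq0 => /(_ wz0) /=.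
  rewrite dE [_ *: 1]mulr1 subrK => /ltW h.
  rewrite (_ : f w - _ - _ = ((w - z)^-1 * (f w - f z) - d) * (w - z)).
    by rewrite cabsM ler_wpM2r ?cabs_ge0.
  by field; rewrite subr_eq0.
have cv : (fun h : C => h^-1 *: ((f \o shift z) (h *: (1 : C)) - f z)) @
    (0 : C)^' --> d.
  move=> A /nbhs_cabsP[e e0 eA].
  have [r r0 rP] := fd _ (divr_gt0 e0 (ltr0Sn R 1)).
  apply/nbhs_cabsP; exists r => // h; rewrite subr0 => hr h0.
  apply: eA => /=; have := rP (h + z); rewrite addrK => /(_ hr).
  rewrite [h *: 1]mulr1 => le; have h0' : 0 < cabs h by rewrite cabs_gt0.
  rewrite (_ : _ - d = (f (h + z) - f z - d * h) * h^-1).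
    rewrite cabsM cabsV ltr_pdivrMr//; apply: le_lt_trans le _.
    by rewrite ltr_pM2r// ltr_pdivrMr// ltr_pMr// ltr1n.
  by rewrite /GRing.scale/=; field.
apply: DeriveDef; first by apply/cvg_ex; exists d.
by apply: cvg_lim => //; exact: norm_hausdorff.
Qed.

Lemma has_cderivP f z d :
  has_cderiv f z d <-> derivable f z 1 /\ 'D_1 f z = d.
Proof.
split=> [/is_derive_has_cderiv[]//|[df <-]].
by apply/is_derive_has_cderiv; exact: DeriveDef.
Qed.

Lemma derivable_has_cderiv f z : derivable f z 1 -> has_cderiv f z ('D_1 f z).
Proof. by move=> df; apply/has_cderivP. Qed.

Lemma has_cderiv_derive f z d : has_cderiv f z d -> 'D_1 f z = d.
Proof. by move=> /has_cderivP[]. Qed.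

Lemma has_cderiv_derivable f z d : has_cderiv f z d -> derivable f z 1.
Proof. by move=> /has_cderivP[]. Qed.

Lemma has_cderiv_near f g z d (r : R) : 0 < r ->
  (forall w, cabs (w - z) < r -> f w = g w) ->
  has_cderiv f z d -> has_cderiv g z d.
Proof.
move=> r0 fg fd e e0; have [s s0 sP] := fd _ e0.
exists (Num.min r s) => [|w]; first by rewrite lt_min r0.
rewrite lt_min => /andP[wr ws]; rewrite -!fg ?subrr ?cabs0//.
exact: sP.
Qed.

Lemma has_cderiv_cst z (c : C) : has_cderiv (fun=> c) z 0.
Proof. by apply/is_derive_has_cderiv; exact: is_derive_cst. Qed.

Lemma has_cderiv_id z : has_cderiv id z 1.
Proof. by apply/is_derive_has_cderiv; exact: is_derive_id. Qed.

Lemma has_cderivD f g z df dg : has_cderiv f z df -> has_cderiv g z dg ->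
  has_cderiv (fun w => f w + g w) z (df + dg).
Proof.
move=> /is_derive_has_cderiv fd /is_derive_has_cderiv gd.
by apply/is_derive_has_cderiv; exact: is_deriveD.
Qed.

Lemma has_cderivB f g z df dg : has_cderiv f z df -> has_cderiv g z dg ->
  has_cderiv (fun w => f w - g w) z (df - dg).
Proof.
move=> /is_derive_has_cderiv fd /is_derive_has_cderiv gd.
by apply/is_derive_has_cderiv; exact: is_deriveB.
Qed.

Lemma has_cderivM f g z df dg : has_cderiv f z df -> has_cderiv g z dg ->
  has_cderiv (fun w => f w * g w) z (f z * dg + g z * df).
Proof.
move=> /is_derive_has_cderiv fd /is_derive_has_cderiv gd.
by apply/is_derive_has_cderiv; exact: is_deriveM.
Qed.

Lemma has_cderivZ (c : C) f z df : has_cderiv f z df ->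
  has_cderiv (fun w => c * f w) z (c * df).
Proof.
move=> fd; have := has_cderivM (has_cderiv_cst z c) fd.
by rewrite mulr0 addr0.
Qed.

Lemma has_cderivV f z df : f z != 0 -> has_cderiv f z df ->
  has_cderiv (fun w => (f w)^-1) z (- df / f z ^+ 2).
Proof.
move=> fz0 /has_cderivP[fd <-]; apply/has_cderivP; split.
  exact: derivableV.
by rewrite deriveV//= /GRing.scale/=; field.
Qed.

Lemma has_cderivX f z n df : has_cderiv f z df ->
  has_cderiv (fun w => f w ^+ n) z (n%:R * f z ^+ n.-1 * df).
Proof.
move=> /is_derive_has_cderiv fd; apply/is_derive_has_cderiv.
rewrite (_ : (fun w => _) = f ^+ n); first exact: is_deriveX.
by apply/funext => w; rewrite exprfctE.
Qed.

Lemma has_cderiv_lipschitz f z d : has_cderiv f z d ->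
  exists2 r : R, 0 < r & forall w, cabs (w - z) < r ->
    cabs (f w - f z) <= (cabs d + 1) * cabs (w - z).
Proof.
move=> /(_ _ ltr01)[r r0 rP]; exists r => // w /rP le.
rewrite (_ : f w - f z = (f w - f z - d * (w - z)) + d * (w - z)).
  by apply: le_trans (cabsD _ _) _; rewrite cabsM mulrDl addrC lerD2l.
by ring.
Qed.

Definition ccont f z : Prop := forall e : R, 0 < e ->
  exists2 r : R, 0 < r & forall w, cabs (w - z) < r -> cabs (f w - f z) < e.

Lemma has_cderiv_cont f z d : has_cderiv f z d -> ccont f z.
Proof.
move=> /has_cderiv_lipschitz[r r0 rP] e e0.
have d1 : 0 < cabs d + 1 by rewrite ltr_wpDl ?cabs_ge0.
exists (Num.min r (e / (cabs d + 1))) => [|w].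
  by rewrite lt_min r0 divr_gt0.
rewrite lt_min ltr_pdivlMr// => /andP[/rP le we].
by apply: le_lt_trans le _; rewrite mulrC.
Qed.

Lemma has_cderiv_comp f g z df dg : has_cderiv f z df ->
  has_cderiv g (f z) dg -> has_cderiv (fun w => g (f w)) z (dg * df).
Proof.
move=> fd gd e e0; have [r r0 rP] := has_cderiv_lipschitz fd.
have df1 : 0 < cabs df + 1 by rewrite ltr_wpDl ?cabs_ge0.
have dg1 : 0 < cabs dg + 1 by rewrite ltr_wpDl ?cabs_ge0.
have e1 : 0 < e / 2 / (cabs df + 1) by rewrite !divr_gt0.
have e2 : 0 < e / 2 / (cabs dg + 1) by rewrite !divr_gt0.
have [s s0 sP] := gd _ e1; have [t t0 tP] := fd _ e2.
have [u u0 uP] := has_cderiv_cont fd s0.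
exists (Num.min r (Num.min t u)) => [|w]; first by rewrite !lt_min r0 t0.
rewrite !lt_min => /and3P[/rP le /tP le1 /uP/sP le2].
rewrite (_ : g (f w) - g (f z) - _ = (g (f w) - g (f z) - dg * (f w - f z)) +
   dg * (f w - f z - df * (w - z))); last by ring.
apply: le_trans (cabsD _ _) _; rewrite (splitr e) mulrDl.
apply: lerD.
  apply: le_trans le2 _; rewrite -mulrA ler_pM2l ?divr_gt0//.
  by rewrite ler_pdivrMl.
rewrite cabsM.
apply: le_trans (_ : (cabs dg + 1) *
  (e / 2 / (cabs dg + 1) * cabs (w - z)) <= _).
  by rewrite ler_pM ?cabs_ge0 ?lerDl.
by rewrite mulrA (mulrC (cabs dg + 1)) divfK ?gt_eqF.
Qed.

End Derivatives.

(** * Curves and segment integrals *)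

Section Curves.
Variable R : realType.
Local Notation C := (cplx R).
Implicit Types (f : C -> C) (G H : R -> C) (x y z c d : C) (a r s t : R).

(** C is taken here as a normed space over itself, so differentiation along a real parameter needs a
    notion of its own. *)
Definition has_rderiv G t d : Prop := forall e : R, 0 < e ->
  exists2 r : R, 0 < r & forall s, `|s - t| < r ->
    cabs (G s - G t - d * (s - t)%:C) <= e * `|s - t|.

Lemma is_derive_real_epsP (u : R -> R) t (d : R) :
  is_derive t 1 u d <-> forall e : R, 0 < e ->
  exists2 r : R, 0 < r & forall s, `|s - t| < r ->
    `|u s - u t - d * (s - t)| <= e * `|s - t|.
Proof.
split=> [[du dE] e e0|ud].
  have : nbhs d [set w : R | `|d - w| < e] by apply/nbhs_ballP; exists e.
  rewrite -dE => /du /nbhs_ballP[r /= r0 rP]; exists r => // s st.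
  have [->|st0] := eqVneq s t.
    by rewrite !subrr mulr0 subr0 normr0 mulr0.
  have := rP (s - t); rewrite /ball/= sub0r normrN => /(_ st).
  rewrite subr_eq0 => /(_ st0) /=.
  rewrite dE /GRing.scale/= mulr1 subrK => /ltW h.
  rewrite (_ : u s - _ - _ = - (d - (s - t)^-1 * (u s - u t)) * (s - t)).
    by rewrite normrM normrN ler_wpM2r.
  by field; rewrite subr_eq0.
have cv : (fun h : R => h^-1 *: ((u \o shift t) (h *: (1 : R)) - u t)) @
    (0 : R)^' --> d.
  move=> A /nbhs_ballP[e /= e0 eA].
  have [r r0 rP] := ud _ (divr_gt0 e0 (ltr0Sn R 1)).
  apply/nbhs_ballP; exists r => //= h; rewrite /ball/= sub0r normrN => hr h0.
  apply: eA; rewrite /ball/= distrC; have := rP (h + t); rewrite addrK => /(_ hr).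
  rewrite /GRing.scale/= mulr1 => le; have h0' : 0 < `|h| by rewrite normr_gt0.
  rewrite (_ : _ - d = (u (h + t) - u t - d * h) * h^-1).
    rewrite normrM normfV ltr_pdivrMr//; apply: le_lt_trans le _.
    by rewrite ltr_pM2r// ltr_pdivrMr// ltr_pMr// ltr1n.
  by field.
apply: DeriveDef; first by apply/cvg_ex; exists d.
by apply: cvg_lim => //; exact: norm_hausdorff.
Qed.

(** The real part of c G is the component of G along the conjugate of c; this is how the real mean
    value theorem reaches curves in C. *)
Lemma has_rderiv_re c G t d : has_rderiv G t d ->
  is_derive t 1 (fun s => re (c * G s)) (re (c * d)).
Proof.
move=> Gd; apply/is_derive_real_epsP => e e0.
have c1 : 0 < cabs c + 1 by rewrite ltr_wpDl ?cabs_ge0.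
have [r r0 rP] := Gd _ (divr_gt0 e0 c1); exists r => // s /rP le.
rewrite [re (c * d) * _]mulrC -ReZ -!ReB; apply: le_trans (Re_cabs _) _.
rewrite (_ : c * G s - _ - _ = c * (G s - G t - d * (s - t)%:C)); last by ring.
rewrite cabsM; apply: le_trans (_ : (cabs c + 1) *
   (e / (cabs c + 1) * `|s - t|) <= _).
  by rewrite ler_pM ?cabs_ge0 ?lerDl.
by rewrite mulrA (mulrC (cabs c + 1)) divfK ?gt_eqF.
Qed.

Lemma has_rderivB G H t x y : has_rderiv G t x -> has_rderiv H t y ->
  has_rderiv (fun s => G s - H s) t (x - y).
Proof.
move=> Gx Hy e e0; have e2 : 0 < e / 2 by rewrite divr_gt0.
have [r r0 rP] := Gx _ e2; have [s s0 sP] := Hy _ e2.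
exists (Num.min r s) => [|w]; first by rewrite lt_min r0.
rewrite lt_min => /andP[/rP h1 /sP h2].
rewrite (_ : G w - _ - _ - _ = (G w - G t - x * (w - t)%:C) -
  (H w - H t - y * (w - t)%:C)); last by ring.
by apply: le_trans (cabsB _ _) _; rewrite (splitr e) mulrDl lerD.
Qed.

Lemma has_rderiv_line x y t : has_rderiv (fun s => x + s%:C * y) t y.
Proof.
move=> e e0; exists 1 => // s _.
rewrite (_ : _ - _ = 0) ?cabs0 ?mulr_ge0 ?(ltW e0)//.
by rewrite rmorphB; ring.
Qed.

Lemma has_rderiv_affine G t (p q : R) d : has_rderiv G (p + q * t) d ->
  has_rderiv (fun s => G (p + q * s)) t (q%:C * d).
Proof.
move=> Gd e e0; have q1 : 0 < `|q| + 1 by rewrite ltr_wpDl.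
have [r r0 rP] := Gd _ (divr_gt0 e0 q1).
exists (r / (`|q| + 1)) => [|s]; first by rewrite divr_gt0.
rewrite ltr_pdivlMr// => st; have qst : p + q * s - (p + q * t) = q * (s - t) by ring.
have := rP (p + q * s); rewrite qst normrM rmorphM.
have le : `|q| * `|s - t| <= `|s - t| * (`|q| + 1).
  by rewrite mulrC ler_wpM2l ?lerDl.
move=> /(_ (le_lt_trans le st)) h.
rewrite (_ : q%:C * d * _ = d * (q%:C * (s - t)%:C)); last by ring.
apply: le_trans h _; apply: le_trans (ler_wpM2l _ le) _.
  by rewrite divr_ge0 ?ltW.
by rewrite [X in _ * X]mulrC mulrA divfK ?gt_eqF.
Qed.

Lemma has_rderiv_comp f G t x y : has_rderiv G t x -> has_cderiv f (G t) y ->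
  has_rderiv (fun s => f (G s)) t (y * x).
Proof.
move=> Gx fy e e0; have [r1 r10 rP1] := Gx _ ltr01.
have x1 : 0 < cabs x + 1 by rewrite ltr_wpDl ?cabs_ge0.
have y1 : 0 < cabs y + 1 by rewrite ltr_wpDl ?cabs_ge0.
have lip s : `|s - t| < r1 -> cabs (G s - G t) <= (cabs x + 1) * `|s - t|.
  move=> /rP1 le; rewrite (_ : G s - G t =
    (G s - G t - x * (s - t)%:C) + x * (s - t)%:C); last by ring.
  apply: le_trans (cabsD _ _) _; rewrite cabsM cabs_real mulrDl addrC lerD2l.
  exact: le.
have e1 : 0 < e / 2 / (cabs x + 1) by rewrite !divr_gt0.
have e2 : 0 < e / 2 / (cabs y + 1) by rewrite !divr_gt0.
have [r2 r20 rP2] := fy _ e1; have [r3 r30 rP3] := Gx _ e2.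
exists (Num.min r1 (Num.min (r2 / (cabs x + 1)) r3)) => [|s].
  by rewrite !lt_min r10 r30 divr_gt0.
rewrite !lt_min => /and3P[s1 s2 s3]; have le1 := lip _ s1.
have lt2 : cabs (G s - G t) < r2.
  by apply: le_lt_trans le1 _; rewrite mulrC -ltr_pdivlMr.
have le2 := rP2 _ lt2; have le3 := rP3 _ s3.
rewrite (_ : f (G s) - f (G t) - _ = (f (G s) - f (G t) - y * (G s - G t)) +
   y * (G s - G t - x * (s - t)%:C)); last by ring.
apply: le_trans (cabsD _ _) _; rewrite (splitr e) mulrDl; apply: lerD.
  apply: le_trans le2 _; rewrite -mulrA ler_pM2l ?divr_gt0//.
  by rewrite ler_pdivrMl.
rewrite cabsM; apply: le_trans (_ : (cabs y + 1) *
  (e / 2 / (cabs y + 1) * `|s - t|) <= _).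
  by rewrite ler_pM ?cabs_ge0 ?lerDl.
by rewrite mulrA (mulrC (cabs y + 1)) divfK ?gt_eqF.
Qed.

Lemma real_mean_value (u du : R -> R) :
  (forall t, 0 <= t <= 1 -> is_derive t 1 u (du t)) ->
  exists2 c, 0 <= c <= 1 & u 1 - u 0 = du c.
Proof.
move=> ud; have [||c c01 ->] := @MVT_segment R u du 0 1 ler01.
- move=> t t01; apply: ud.
  by have := subset_itv_oo_cc t01; rewrite in_itv.
- apply: derivable_within_continuous => t.
  by rewrite in_itv/= => /ud[].
by exists c; [move: c01; rewrite in_itv|rewrite subr0 mulr1].
Qed.

(* The real mean value theorem, applied to the component of G along
   G 1 - G 0. *)
Lemma curve_mean_value G (D : R -> C) (K : R) :
  (forall t, 0 <= t <= 1 -> has_rderiv G t (D t) /\ cabs (D t) <= K) ->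
  cabs (G 1 - G 0) <= K.
Proof.
move=> GD; set v := G 1 - G 0.
have [t /GD[/has_rderiv_re h _]|c c01] :=
  @real_mean_value (fun s => re (conjc v * G s)) (fun t => re (conjc v * D t)).
  exact: h.
rewrite -ReB -mulrBr -/v -sqr_cabs/= => h.
have [_ DK] : has_rderiv G c (D c) /\ cabs (D c) <= K by exact: GD.
have : cabs v ^+ 2 <= cabs v * K.
  rewrite h; apply: le_trans (ler_norm _) _; apply: le_trans (Re_cabs _) _.
  by rewrite cabsM cabs_conj ler_wpM2l ?cabs_ge0.
have := cabs_ge0 v; rewrite le_eqVlt => /predU1P[<- _|v0].
  by apply: le_trans DK; exact: cabs_ge0.
by rewrite expr2 ler_pM2l.
Qed.

(** Integrating from -1 inside [-1, 2] makes 0 and 1 interior points, so that the fundamental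
    theorem of calculus gives two-sided derivatives on all of [0, 1]. *)
Lemma has_rderiv_primitive_real (u : R -> R) : continuous u ->
  exists U : R -> R, forall t, 0 <= t <= 1 -> is_derive t 1 U (u t).
Proof.
move=> uc; have ui : (@lebesgue_measure R).-integrable `[-1, 2] (EFin \o u).
  apply: continuous_compact_integrable; first exact: segment_compact.
  exact: continuous_subspaceT.
exists (fun x : R => \int[lebesgue_measure]_(t in [set` `[-1, x]]) (u t))%R.
move=> t /andP[t0 t1]; have t2 : t < 2 by apply: le_lt_trans t1 _; rewrite ltr1n.
have [|d e] := continuous_FTC1_closed t2 ui _ (uc t).
  by apply: lt_le_trans t0; rewrite ltrN10.
by apply: DeriveDef d _; rewrite -derive1E.
Qed.

Lemma has_rderiv_primitive (g : R -> C) :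
  (forall t (e : R), 0 < e -> exists2 r : R, 0 < r &
    forall s, `|s - t| < r -> cabs (g s - g t) < e) ->
  exists G, forall t, 0 <= t <= 1 -> has_rderiv G t (g t).
Proof.
move=> gc.
have rec : continuous (fun t => re (g t)).
  move=> t A /nbhs_ballP[e /= e0 eA]; have [r r0 rP] := gc t _ e0.
  apply/nbhs_ballP; exists r => // s; rewrite /ball/= distrC => /rP h.
  apply: eA; rewrite /ball/= distrC -ReB.
  by apply: le_lt_trans (Re_cabs _) h.
have imc : continuous (fun t => im (g t)).
  move=> t A /nbhs_ballP[e /= e0 eA]; have [r r0 rP] := gc t _ e0.
  apply/nbhs_ballP; exists r => // s; rewrite /ball/= distrC => /rP h.
  apply: eA; rewrite /ball/= distrC -ImB.
  by apply: le_lt_trans (Im_cabs _) h.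
have [U dU] := has_rderiv_primitive_real rec.
have [V dV] := has_rderiv_primitive_real imc.
exists (fun t => U t +i* V t) => t t01 e e0; have e2 : 0 < e / 2 by rewrite divr_gt0.
have /is_derive_real_epsP/(_ _ e2)[r r0 rP] := dU t t01.
have /is_derive_real_epsP/(_ _ e2)[s s0 sP] := dV t t01.
exists (Num.min r s) => [|w]; first by rewrite lt_min r0.
rewrite lt_min => /andP[/rP h1 /sP h2]; apply: le_trans (cabs_ReIm _) _.
rewrite (splitr e) mulrDl !ReB !ImB; case: (g t) h1 h2 => p q /= h1 h2.
by rewrite !mulr0 subr0 add0r lerD.
Qed.

End Curves.

(** * Limits with explicit error bounds *)

Section Completeness.
Variable R : realType.
Local Notation C := (cplx R).

Lemma expr_small (q e : R) : 0 <= q < 1 -> 0 < e -> exists n, q ^+ n < e.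
Proof.
move=> /andP[q0 q1] e0; have : q ^+ n @[n --> \oo] --> (0 : R).
  by apply: cvg_expr; rewrite ger0_norm.
move=> /cvgrPdist_lt/(_ _ e0)[N _ /(_ N (leqnn N))] /= h.
by exists N; move: h; rewrite sub0r normrN ger0_norm ?exprn_ge0.
Qed.

Lemma expr_small_mul (x q e : R) : 0 <= q < 1 -> 0 < e ->
  exists n, x * q ^+ n < e.
Proof.
move=> q01 e0; have x1 : 0 < `|x| + 1 by rewrite ltr_wpDl.
have [n nP] := expr_small q01 (divr_gt0 e0 x1); exists n.
move: nP; rewrite ltr_pdivlMr// mulrC; apply: le_lt_trans.
rewrite ler_wpM2r//; first by apply: exprn_ge0; case/andP: q01.
by apply: le_trans (ler_norm x) _; rewrite lerDl.
Qed.

(** The intervals [u n - b n, u n + b n] meet pairwise, so the supremum of their left ends lies in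
    all of them. The error bound comes with the limit. *)
Lemma real_tail_limit (u b : nat -> R) :
  (forall n m, (n <= m)%N -> `|u n - u m| <= b n) ->
  exists l, forall n, `|u n - l| <= b n.
Proof.
move=> ub; have b0 n : 0 <= b n by have := ub n n (leqnn n); rewrite subrr normr0.
have le n m : u n - b n <= u m + b m.
  have [nm|/ltnW mn] := leqP n m.
    have := ub _ _ nm; rewrite ler_norml => /andP[_].
    by have := b0 m; lra.
  have := ub _ _ mn; rewrite ler_norml => /andP[].
  by have := b0 n; lra.
pose A := [set u n - b n | n in [set: nat]].
have supA : has_sup A.
  by split; [exists (u 0 - b 0), 0|exists (u 0 + b 0) => _ [n _ <-]].
exists (sup A) => n; rewrite ler_norml; apply/andP; split.
  suff : sup A <= u n + b n by lra.
  by apply: ge_sup => [|_ [m _ <-]]; first by case: supA.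
suff : u n - b n <= sup A by lra.
by apply: ub_le_sup; [case: supA|exists n].
Qed.

Lemma complex_tail_limit (u : nat -> C) (b : nat -> R) :
  (forall n m, (n <= m)%N -> cabs (u n - u m) <= b n) ->
  exists l, forall n, cabs (u n - l) <= 2 * b n.
Proof.
move=> ub.
have [n m nm|p pP] := @real_tail_limit (fun n => re (u n)) b.
  by rewrite -ReB; apply: le_trans (Re_cabs _) (ub _ _ nm).
have [n m nm|q qP] := @real_tail_limit (fun n => im (u n)) b.
  by rewrite -ImB; apply: le_trans (Im_cabs _) (ub _ _ nm).
exists (p +i* q) => n; apply: le_trans (cabs_ReIm _) _.
by rewrite ReB ImB mulr_natl mulr2n lerD.
Qed.

End Completeness.

(** * Integrals along segments *)

Section SegmentIntegral.
Variable R : realType.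
Local Notation C := (cplx R).
Implicit Types (f Q q : C -> C) (a b c p z w : C) (s t : R).

Definition segpt a b t : C := a + t%:C * (b - a).

Lemma segpt0 a b : segpt a b 0 = a.
Proof. by rewrite /segpt mul0r addr0. Qed.

Lemma segpt1 a b : segpt a b 1 = b.
Proof. by rewrite /segpt mul1r; ring. Qed.

Lemma segpt_dist a b t z : 0 <= t <= 1 ->
  cabs (segpt a b t - z) <= cabs (a - z) + cabs (b - a).
Proof.
move=> /andP[t0 t1]; rewrite /segpt.
rewrite (_ : _ - z = (a - z) + t%:C * (b - a)); last by ring.
apply: le_trans (cabsD _ _) _; rewrite lerD2l cabsM cabs_real ger0_norm//.
by rewrite ler_piMl ?cabs_ge0.
Qed.

(** The integral is encoded as the increment of a primitive of the integrand pulled back to [0, 1].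
    The mean value inequality for curves then gives both its uniqueness and all estimates. *)
Definition is_segint f a b (J : C) := exists2 G : R -> C,
  (forall t, 0 <= t <= 1 -> has_rderiv G t (f (segpt a b t) * (b - a))) &
  J = G 1 - G 0.

Definition segint f a b : C := get (is_segint f a b).

(** An integrand q with a known primitive Q is subtracted, and the rest is estimated by its size. It
    serves with q affine in Goursat's theorem and with q constant in the mean value bound on
    circles. *)
Lemma is_segint_approx f a b J Q q (K : R) : is_segint f a b J ->
  (forall t, 0 <= t <= 1 -> has_cderiv Q (segpt a b t) (q (segpt a b t)) /\
     cabs (f (segpt a b t) - q (segpt a b t)) <= K) ->
  cabs (J - (Q b - Q a)) <= K * cabs (b - a).
Proof.
move=> [G dG ->] QK.
rewrite (_ : _ - _ = (G 1 - Q (segpt a b 1)) - (G 0 - Q (segpt a b 0))).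
  apply: (@curve_mean_value _ (fun s => G s - Q (segpt a b s))
    (fun t => f (segpt a b t) * (b - a) - q (segpt a b t) * (b - a))).
  move=> t t01; have [dQ le] := QK t t01; split.
    apply: has_rderivB; first exact: dG.
    by apply: has_rderiv_comp dQ; exact: has_rderiv_line.
  by rewrite -mulrBl cabsM ler_wpM2r ?cabs_ge0.
by rewrite segpt0 segpt1; ring.
Qed.

Lemma is_segint_unique f a b J J' :
  is_segint f a b J -> is_segint f a b J' -> J = J'.
Proof.
move=> [G dG ->] [H dH ->]; apply/eqP; rewrite -subr_eq0 -cabs_eq0.
rewrite eq_le cabs_ge0 andbT.
rewrite (_ : _ - _ = (G 1 - H 1) - (G 0 - H 0)); last by ring.
apply: (@curve_mean_value _ (fun s => G s - H s) (fun=> 0)) => t t01.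
rewrite cabs0; split => //.
rewrite -(subrr (f (segpt a b t) * (b - a))).
by apply: has_rderivB; [exact: dG|exact: dH].
Qed.

Lemma segintE f a b J : is_segint f a b J -> segint f a b = J.
Proof.
move=> h; apply: is_segint_unique (h).
exact: (@getPex _ (is_segint f a b) (ex_intro _ _ h)).
Qed.

Lemma segintP f a b :
  (forall t, 0 <= t <= 1 -> ccont f (segpt a b t)) ->
  is_segint f a b (segint f a b).
Proof.
move=> fc; apply: getPex.
(* f is continuous only at points of the segment; clamping the parameter to [0, 1] extends the
   integrand continuously to the whole line. *)
pose k t : R := Num.max 0 (Num.min 1 t).
have k01 t : 0 <= k t <= 1 by rewrite /k le_max lexx /= ge_max ler01 ge_min lexx.
have kid t : 0 <= t <= 1 -> k t = t.
  by move=> /andP[t0 t1]; rewrite /k (min_idPr t1) (max_idPr t0).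
have klip s t : `|k s - k t| <= `|s - t|.
  have := ler_norm (s - t); have := ler_norm (t - s).
  rewrite (distrC t) ler_norml /k; move: (normr_ge0 (s - t)) => h0 hs ht.
  have [s1|s1] := leP 1 s; have [t1|t1] := leP 1 t;
    have [s0|s0] := leP 0 s; have [t0|t0] := leP 0 t;
    rewrite ?(max_idPr ler01); apply/andP; split; lra.
have ba1 : 0 < cabs (b - a) + 1 by rewrite ltr_wpDl ?cabs_ge0.
have [|G dG] := @has_rderiv_primitive R (fun t => f (segpt a b (k t)) * (b - a)).
  move=> t e e0; have [r r0 rP] := fc _ (k01 t) _ (divr_gt0 e0 ba1).
  exists (r / (cabs (b - a) + 1)) => [|s]; first by rewrite divr_gt0.
  rewrite ltr_pdivlMr// => st; rewrite -mulrBl cabsM.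
  have := rP (segpt a b (k s)).
  rewrite (_ : segpt a b (k s) - _ = (k s - k t)%:C * (b - a)); last first.
    by rewrite /segpt rmorphB; ring.
  have le : `|k s - k t| * cabs (b - a) <= `|s - t| * (cabs (b - a) + 1).
    by rewrite ler_pM ?cabs_ge0 ?lerDl.
  rewrite cabsM cabs_real => /(_ (le_lt_trans le st)).
  rewrite ltr_pdivlMr//; apply: le_lt_trans.
  by rewrite ler_wpM2l ?cabs_ge0 ?lerDl.
exists (G 1 - G 0), G => // t t01; have := dG t t01.
by rewrite kid.
Qed.

Lemma segint_approx f a b Q q (K : R) :
  (forall t, 0 <= t <= 1 -> ccont f (segpt a b t)) ->
  (forall t, 0 <= t <= 1 -> has_cderiv Q (segpt a b t) (q (segpt a b t)) /\
     cabs (f (segpt a b t) - q (segpt a b t)) <= K) ->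
  cabs (segint f a b - (Q b - Q a)) <= K * cabs (b - a).
Proof. by move=> /segintP; exact: is_segint_approx. Qed.

Lemma segint_rev f a b : (forall t, 0 <= t <= 1 -> ccont f (segpt a b t)) ->
  segint f b a = - segint f a b.
Proof.
move=> /segintP[G dG ->]; apply: segintE.
exists (fun s => G (1 + (-1) * s)) => [t /andP[t0 t1]|]; last first.
  by rewrite mulr1 mulr0 subrr addr0 opprB.
rewrite (_ : segpt b a t = segpt a b (1 + -1 * t)); last first.
  by rewrite /segpt rmorphD rmorphM rmorphN !rmorph1; ring.
rewrite (_ : _ * _ = (-1)%:C * (f (segpt a b (1 + -1 * t)) * (b - a))).
  by apply: has_rderiv_affine; apply: dG; apply/andP; split; lra.
by rewrite rmorphN rmorph1; ring.
Qed.

Lemma segint_split f a b m : (forall t, 0 <= t <= 1 -> ccont f (segpt a b t)) ->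
  m = (a + b) / 2 -> segint f a b = segint f a m + segint f m b.
Proof.
move=> /segintP[G dG ->] ->.
have half : (2^-1)%:C = 2^-1 :> C by rewrite fmorphV rmorph_nat.
have two0 : (2 : C) != 0 by rewrite pnatr_eq0.
rewrite (@segintE f a _ (G (0 + 2^-1 * 1) - G (0 + 2^-1 * 0))); last first.
  exists (fun s => G (0 + 2^-1 * s)) => // t /andP[t0 t1].
  rewrite (_ : segpt a _ t = segpt a b (0 + 2^-1 * t)); last first.
    by rewrite /segpt add0r rmorphM /= half; field.
  rewrite (_ : _ * _ = (2^-1)%:C * (f (segpt a b (0 + 2^-1 * t)) * (b - a))).
    by apply: has_rderiv_affine; apply: dG; apply/andP; split; lra.
  by rewrite half; field.
rewrite (@segintE f _ b (G (2^-1 + 2^-1 * 1) - G (2^-1 + 2^-1 * 0))); last first.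
  exists (fun s => G (2^-1 + 2^-1 * s)) => // t /andP[t0 t1].
  rewrite (_ : segpt _ b t = segpt a b (2^-1 + 2^-1 * t)); last first.
    by rewrite /segpt rmorphD rmorphM /= half; field.
  rewrite (_ : _ * _ = (2^-1)%:C * (f (segpt a b (2^-1 + 2^-1 * t)) * (b - a))).
    by apply: has_rderiv_affine; apply: dG; apply/andP; split; lra.
  by rewrite half; field.
rewrite !mulr0 !mulr1 !addr0 add0r (_ : 2^-1 + 2^-1 = 1 :> R); last by field.
by ring.
Qed.

Lemma segint_translate f a b p :
  (forall t, 0 <= t <= 1 -> ccont f (segpt a b t)) ->
  (forall w, f (w + p) = f w) ->
  segint f (a + p) (b + p) = segint f a b.
Proof.
move=> /segintP[G dG ->] fp; apply: segintE; exists G => // t t01.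
rewrite (_ : segpt _ _ t = segpt a b t + p) ?fp; last by rewrite /segpt; ring.
by rewrite (_ : b + p - (a + p) = b - a); [exact: dG|ring].
Qed.

End SegmentIntegral.

(** * Goursat's theorem *)

Section Goursat.
Variable R : realType.
Local Notation C := (cplx R).
Variables (H : set C) (f : C -> C).
Hypothesis convH : forall a b (t : R), H a -> H b -> 0 <= t <= 1 ->
  H (segpt a b t).
Hypothesis closedH : forall z, closure H z -> H z.
Hypothesis holoH : forall z, H z -> exists d, has_cderiv f z d.

Let contH a b (t : R) : H a -> H b -> 0 <= t <= 1 -> ccont f (segpt a b t).
Proof.
by move=> Ha Hb t01; have [d /has_cderiv_cont] := holoH (convH Ha Hb t01).
Qed.

Let T := (C * C * C)%type.
Let inH (T0 : T) := [/\ H T0.1.1, H T0.1.2 & H T0.2].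
Let S (T0 : T) := segint f T0.1.1 T0.1.2 + segint f T0.1.2 T0.2 +
  segint f T0.2 T0.1.1.
Let L (T0 : T) := cabs (T0.1.2 - T0.1.1) + cabs (T0.2 - T0.1.2) +
  cabs (T0.1.1 - T0.2).

Let half2 (z : C) : cabs (z / 2) = cabs z / 2.
Proof.
by rewrite cabsM cabsV (_ : (2 : C) = (2 : R)%:C) ?cabs_real ?gtr0_norm// rmorph_nat.
Qed.

Let midH a b : H a -> H b -> H ((a + b) / 2).
Proof.
move=> Ha Hb; rewrite (_ : _ / 2 = segpt a b (2^-1)); first by apply: convH => //; lra.
rewrite /segpt (_ : (2^-1)%:C = 2^-1 :> C); last by rewrite fmorphV rmorph_nat.
by field.
Qed.

(** The integrals over the inner edges of the four medial triangles cancel, so one of the triangles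
    carries at least a quarter of the total. The bound on the displacement of the first vertex makes
    the chosen triangles converge to a point. *)
Let bisect (T0 : T) : inH T0 -> exists T1 : T,
  [/\ inH T1, L T1 = L T0 / 2, cabs (S T0) <= 4 * cabs (S T1) &
      cabs (T1.1.1 - T0.1.1) <= L T0].
Proof.
case: T0 => [[a b] c] [/= Ha Hb Hc].
pose p := (a + b) / 2; pose q := (b + c) / 2; pose s := (c + a) / 2.
have [Hp Hq Hs] : [/\ H p, H q & H s] by split; exact: midH.
have two0 : (2 : C) != 0 by rewrite pnatr_eq0.
have sum : S (a, b, c) = S (a, p, s) + S (p, b, q) + S (s, q, c) + S (q, s, p).
  rewrite /S /= (@segint_split _ f a b p)//; last by move=> t; exact: contH.
  rewrite (@segint_split _ f b c q)//; last by move=> t; exact: contH.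
  rewrite (@segint_split _ f c a s)//; last by move=> t; exact: contH.
  rewrite (@segint_rev _ f s p); last by move=> t; exact: contH.
  rewrite (@segint_rev _ f p q); last by move=> t; exact: contH.
  rewrite (@segint_rev _ f q s); last by move=> t; exact: contH.
  by ring.
have ps : cabs (s - p) = cabs (c - b) / 2.
  by rewrite -half2; congr cabs; rewrite /s /p; field.
have qp : cabs (p - q) = cabs (a - c) / 2.
  by rewrite -half2; congr cabs; rewrite /q /p; field.
have sq : cabs (q - s) = cabs (b - a) / 2.
  by rewrite -half2; congr cabs; rewrite /q /s; field.
have ap : cabs (p - a) = cabs (b - a) / 2.
  by rewrite -half2; congr cabs; rewrite /p; field.
have pb : cabs (b - p) = cabs (b - a) / 2.
  by rewrite -half2; congr cabs; rewrite /p; field.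
have bq : cabs (q - b) = cabs (c - b) / 2.
  by rewrite -half2; congr cabs; rewrite /q; field.
have qc : cabs (c - q) = cabs (c - b) / 2.
  by rewrite -half2; congr cabs; rewrite /q; field.
have cs : cabs (s - c) = cabs (a - c) / 2.
  by rewrite -half2; congr cabs; rewrite /s; field.
have sa : cabs (a - s) = cabs (a - c) / 2.
  by rewrite -half2; congr cabs; rewrite /s; field.
move: (cabs_ge0 (b - a)) (cabs_ge0 (c - b)) (cabs_ge0 (a - c)) => n1 n2 n3.
pose big T1 := cabs (S (a, b, c)) <= 4 * cabs (S T1).
have [h1|/negP h1] := boolP (big (a, p, s)).
  exists (a, p, s); split => //=; rewrite /L /= ?subrr ?cabs0 ?ap ?ps ?sa; lra.
have [h2|/negP h2] := boolP (big (p, b, q)).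
  exists (p, b, q); split => //=; rewrite /L /= ?ap ?pb ?bq ?qp; lra.
have [h3|/negP h3] := boolP (big (s, q, c)).
  exists (s, q, c); split => //=; rewrite /L /= ?sq ?qc ?cs ?(cabsC s) ?sa; lra.
have [h4|/negP h4] := boolP (big (q, s, p)).
  exists (q, s, p); split => //=.
    by rewrite /L /= (cabsC s) sq (cabsC p) ps (cabsC q) qp; lra.
  apply: le_trans (cabs_dist p _ _) _; rewrite (cabsC q) qp ap /L/=; lra.
exfalso; move: h1 h2 h3 h4; rewrite /big !(rwP negP) -!ltNge sum.
set A := S _; set B := S _; set D := S _; set E := S _ => h1 h2 h3 h4.
have : cabs (A + B + D + E) <= cabs A + cabs B + cabs D + cabs E.
  apply: le_trans (cabsD _ _) _; rewrite lerD2r.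
  by apply: le_trans (cabsD _ _) _; rewrite lerD2r; exact: cabsD.
lra.
Qed.

(** The affine part of f at z has the primitive [Q], which contributes nothing around a closed
    triangle; only the remainder is integrated. *)
Let local_bound (z d : C) (T0 : T) (e : R) : inH T0 ->
  (forall w, cabs (w - z) <= cabs (T0.1.1 - z) + 2 * L T0 ->
     cabs (f w - f z - d * (w - z)) <= e) ->
  cabs (S T0) <= e * L T0.
Proof.
case: T0 => [[a b] c] [/= Ha Hb Hc] fe.
pose Q w := f z * w + d * ((w - z) ^+ 2 / 2).
pose q w := f z + d * (w - z).
have two0 : (2 : C) != 0 by rewrite pnatr_eq0.
have dQ w : has_cderiv Q w (q w).
  have -> : q w = f z * 1 + d * ((w - z) ^+ 2 * 0 + 2^-1 * (2%:R * (w - z) ^+ 1 * (1 - 0))).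
    by rewrite /q; field.
  apply: has_cderivD; first by apply: has_cderivZ; exact: has_cderiv_id.
  apply: has_cderivZ; apply: has_cderivM; last exact: has_cderiv_cst.
  apply: (@has_cderivX _ (fun w => w - z) w 2).
  by apply: has_cderivB; [exact: has_cderiv_id|exact: has_cderiv_cst].
move: (cabs_ge0 (b - a)) (cabs_ge0 (c - b)) (cabs_ge0 (a - c)) => n1 n2 n3.
have seg x y : H x -> H y -> cabs (x - z) + cabs (y - x) <=
    cabs (a - z) + 2 * L (a, b, c) ->
    cabs (segint f x y - (Q y - Q x)) <= e * cabs (y - x).
  move=> Hx Hy xy; apply: (@segint_approx _ f x y Q q) => t t01.
    exact: contH.
  split; first exact: dQ.
  rewrite /q opprD addrA; apply: fe.
  by apply: le_trans xy; exact: segpt_dist.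
rewrite /S /= (_ : _ + _ + _ = (segint f a b - (Q b - Q a)) +
   (segint f b c - (Q c - Q b)) + (segint f c a - (Q a - Q c))); last by ring.
rewrite /L !mulrDr; apply: le_trans (cabsD _ _) _; apply: lerD.
  apply: le_trans (cabsD _ _) _; apply: lerD; apply: seg => //.
    by rewrite /L /=; lra.
  by have := cabs_dist a b z; rewrite /L /=; lra.
apply: seg => //; have := cabs_dist a c z.
by rewrite (cabsC c a) /L /=; lra.
Qed.

Theorem Goursat a b c : H a -> H b -> H c ->
  segint f a b + segint f b c + segint f c a = 0.
Proof.
move=> Ha Hb Hc; pose T0 : T := (a, b, c).
have HT0 : inH T0 by [].
have [nx nxP] : exists nx : T -> T, forall U, inH U -> [/\ inH (nx U),
    L (nx U) = L U / 2, cabs (S U) <= 4 * cabs (S (nx U)) &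
    cabs ((nx U).1.1 - U.1.1) <= L U].
  have : forall U, exists U', inH U -> [/\ inH U',
    L U' = L U / 2, cabs (S U) <= 4 * cabs (S U') & cabs (U'.1.1 - U.1.1) <= L U].
    by move=> U; have [/bisect[U' ?]|nU] := pselect (inH U); [exists U'|exists U].
  by move=> /choice[nx nxP]; exists nx.
pose Tn n := iter n nx T0.
have Hn n : inH (Tn n) by elim: n => // n /nxP[].
have Ln n : L (Tn n) = L T0 * 2^-1 ^+ n.
  elim: n => [|n IH]; first by rewrite expr0 mulr1.
  by have [_ -> _ _] := nxP _ (Hn n); rewrite IH exprSr mulrA.
have Sn n : cabs (S T0) * 2^-1 ^+ n * 2^-1 ^+ n <= cabs (S (Tn n)).
  elim: n => [|n IH]; first by rewrite expr0 !mulr1.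
  have [_ _ h _] := nxP _ (Hn n); rewrite -/(Tn n.+1) !exprS.
  set x := 2^-1 ^+ n in IH *; move: (le_trans IH h) => le.
  rewrite (_ : _ * _ = (cabs (S T0) * x * x) / 4); last by field.
  by rewrite ler_pdivrMr// [leRHS]mulrC; exact: le.
have L0 : 0 <= L T0 by rewrite /L !addr_ge0 ?cabs_ge0.
pose u n := (Tn n).1.1.
have un n k : cabs (u (n + k)%N - u n) <= 2 * L T0 * 2^-1 ^+ n * (1 - 2^-1 ^+ k).
  elim: k => [|k IH]; first by rewrite addn0 !subrr mulr0 cabs0.
  rewrite addnS; apply: le_trans (cabs_dist (u (n + k)%N) _ _) _.
  have [_ _ _] := nxP _ (Hn (n + k)%N); rewrite Ln -/(Tn (n + k).+1) => h.
  apply: le_trans (lerD h IH) _; rewrite exprD exprS.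
  by rewrite le_eqVlt; apply/orP; left; apply/eqP; field.
have [|z zP] := @complex_tail_limit _ u (fun n => 2 * L T0 * 2^-1 ^+ n).
  move=> n m nm; rewrite cabsC -(subnKC nm); apply: le_trans (un _ _) _.
  by rewrite ler_piMr ?mulr_ge0 ?exprn_ge0 ?invr_ge0// gerBl exprn_ge0 ?invr_ge0.
have Hz : H z.
  apply: closedH; apply/closure_cabsP => r r0.
  have half : 0 <= (2^-1 : R) < 1 by lra.
  have [n nP] := expr_small_mul (4 * L T0) half r0.
  exists (u n); first by case: (Hn n).
  by apply: le_lt_trans (zP n) _; move: nP; lra.
have [d fd] := holoH Hz.
apply/eqP; rewrite -cabs_eq0 eq_le cabs_ge0 andbT -[X in cabs X]/(S T0).
rewrite leNgt; apply/negP => S0.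
(* The n-th triangle lies within 6 L 2^-n of z: 4 L 2^-n for its first vertex and 2 L 2^-n allowed
   by [local_bound]. Hence |S| 4^-n <= e 6 L^2 4^-n, which this e contradicts; the 1 covers a
   degenerate triangle. *)
pose e := cabs (S T0) / (6 * L T0 * L T0 + 1).
have LL : 0 < 6 * L T0 * L T0 + 1 by rewrite ltr_wpDl// !mulr_ge0.
have e0 : 0 < e by rewrite divr_gt0.
have [r r0 rP] := fd _ e0.
have half : 0 <= (2^-1 : R) < 1 by lra.
have [n nP] := expr_small_mul (6 * L T0) half r0.
set x := 2^-1 ^+ n in nP; have x0 : 0 < x by rewrite exprn_gt0 ?invr_gt0.
have := @local_bound z d (Tn n) (e * (6 * L T0 * x)) (Hn n).
rewrite Ln -/x => /(_ _)/le_trans; have := le_trans (Sn n); rewrite -/x => h1 h2.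
have {h1 h2} : cabs (S T0) * x * x <= e * (6 * L T0 * x) * (L T0 * x).
  apply: h1; apply: h2 => [w|]; last exact: lexx.
  have := zP n; rewrite -/x -/(u n) => zn wz.
  have wz' : cabs (w - z) <= 6 * L T0 * x by lra.
  apply: le_trans (rP w _) _; last by rewrite ler_pM2l.
  by apply: le_lt_trans wz' _.
rewrite (_ : e * _ * _ = e * (6 * L T0 * L T0) * x * x); last by ring.
rewrite !ler_pM2r//.
by rewrite /e mulrAC ler_pdivlMr// ler_pM2l// ; lra.
Qed.

End Goursat.

(** * Cauchy estimates *)

Section ComplexExponential.
Variable R : realType.
Local Notation C := (cplx R).

Definition cexp (w : C) : C := (expR (re w))%:C * (cos (im w) +i* sin (im w)).

Lemma cabs_cexp w : cabs (cexp w) = expR (re w).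
Proof.
rewrite cabsM cabs_real ger0_norm ?expR_ge0// /cabs /= cos2Dsin2 sqrtr1.
by rewrite mulr1.
Qed.

Lemma cexpD v w : cexp (v + w) = cexp v * cexp w.
Proof.
case: v w => [a b] [c d]; rewrite /cexp /= expRD cosD sinD rmorphM.
apply/eqP; rewrite eq_complex /=; apply/andP; split; apply/eqP; ring.
Qed.

Lemma cexp_periodic w : cexp (w + (0 +i* (2 * pi))) = cexp w.
Proof.
case: w => a b; rewrite /cexp /= addr0 (_ : b + _ = b + 2 *+ 1 * pi) //.
by rewrite mulr1n mulrDl !mul1r addrA !cosDpi !sinDpi !opprK.
Qed.

Lemma cexp_deriv0 : has_cderiv cexp 0 1.
Proof.
(* The real and imaginary errors are at most 3 d |w| each, and 6 / 7 < 1. *)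
move=> e e0; pose d := Num.min 1 (e / 7).
have d0 : 0 < d by rewrite lt_min ltr01 divr_gt0.
have d1 : d <= 1 by rewrite /d ge_min lexx.
have de : d <= e / 7 by rewrite /d ge_min lexx orbT.
have /is_derive_real_epsP/(_ _ d0)[r r0 rP] := is_derive_expR (0 : R).
have /is_derive_real_epsP/(_ _ d0)[s s0 sP] := is_derive_cos (0 : R).
have /is_derive_real_epsP/(_ _ d0)[t t0 tP] := is_derive_sin (0 : R).
exists (Num.min (Num.min r s) (Num.min t (d / 2))) => [|w].
  by rewrite !lt_min r0 s0 t0 divr_gt0.
rewrite subr0 mul1r !lt_min => /andP[/andP[wr ws] /andP[wt wd]].
have [xw yw] := (Re_cabs w, Im_cabs w).
move: (rP (re w)) (sP (im w)) (tP (im w)).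
rewrite !subr0 expR0 cos0 sin0 !subr0 oppr0 mul0r !mul1r subr0.
move=> /(_ (le_lt_trans xw wr)) hE /(_ (le_lt_trans yw ws)) hC.
move=> /(_ (le_lt_trans yw wt)) hS.
have -> : cexp 0 = 1 by rewrite /cexp /= expR0 cos0 sin0 mul1r.
apply: le_trans (cabs_ReIm _) _; rewrite !ReB !ImB.
move: (cabs_ge0 w) xw yw wd {wr ws wt}; move: (cabs w) => m m0.
case: w hE hC hS => x y /= hE hC hS xw yw wd; set E := expR x in hE *.
rewrite !mul0r subr0 addr0 subr0.
have cos1 : `|cos y| <= 1 by rewrite ler_norml cos_geN1 cos_le1.
have EB : `|E - 1| <= 2 * m.
  rewrite (_ : E - 1 = (E - 1 - x) + x); last by ring.
  apply: le_trans (ler_normD _ _) _; apply: le_trans (lerD hE xw) _.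
  have : d * `|x| <= 1 * m by apply: ler_pM => //; exact: ltW.
  by lra.
have EB2 : `|E - 1| <= d by lra.
have h1 : `|E * cos y - 1 - x| <= d * m + 2 * (d * m).
  rewrite (_ : _ - _ - _ = (E - 1 - x) * cos y + (1 + x) * (cos y - 1)); last by ring.
  apply: le_trans (ler_normD _ _) _; rewrite !normrM; apply: lerD.
    rewrite -[leRHS]mulr1; apply: ler_pM => //.
    by apply: le_trans hE _; rewrite ler_wpM2l// ltW.
  apply: ler_pM => //.
    by apply: le_trans (ler_normD _ _) _; rewrite normr1; lra.
  by apply: le_trans hC _; rewrite ler_wpM2l// ltW.
have h2 : `|E * sin y - y| <= d * m * 2 + m * d.
  rewrite (_ : _ - _ = (sin y - y) * E + y * (E - 1)); last by ring.
  apply: le_trans (ler_normD _ _) _; rewrite !normrM; apply: lerD.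
    apply: ler_pM => //.
      by apply: le_trans hS _; rewrite ler_wpM2l// ltW.
    rewrite ger0_norm ?expR_ge0//; have := ler_norm (E - 1); lra.
  by apply: ler_pM.
have dm : d * m <= e / 7 * m by rewrite ler_wpM2r.
have em : 0 <= e * m by rewrite mulr_ge0// ltW.
have := lerD h1 h2; lra.
Qed.

Lemma cexp_deriv w : has_cderiv cexp w (cexp w).
Proof.
have -> : cexp = (fun v => cexp w * cexp (v - w)).
  by apply/funext => v; rewrite -cexpD; congr cexp; ring.
have -> : cexp w * cexp (w - w) = cexp w * (1 * (1 - 0)).
  by rewrite subrr subr0 !mulr1 /cexp /= expR0 cos0 sin0 mul1r mulr1.
apply: has_cderivZ; apply: (@has_cderiv_comp _ (fun v => v - w) cexp).
  by apply: has_cderivB; [exact: has_cderiv_id|exact: has_cderiv_cst].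
by rewrite subrr; exact: cexp_deriv0.
Qed.

End ComplexExponential.

Section CauchyEstimate.
Variable R : realType.
Local Notation C := (cplx R).
Implicit Types (f g : C -> C) (z w d : C) (r s M : R).

(* In the coordinate w = log (z - z0), the integral of f over the circle
   |z - z0| = s becomes an integral over a vertical segment of length 2 pi,
   independent of Re w by Goursat's theorem and periodicity. *)
Lemma circle_mean_bound f z0 r s M : 0 < s < r ->
  (forall z, 0 < cabs (z - z0) < r -> exists d, has_cderiv f z d) ->
  ccont f z0 ->
  (forall z, cabs (z - z0) = s -> cabs (f z) <= M) ->
  cabs (f z0) <= M.
Proof.
move=> /andP[s0 sr] fd fc fM.
pose F w := f (z0 + cexp w); pose p : C := 0 +i* (2 * pi).
(* The exponential sends this half-plane onto the closed disc of radius s without its centre. It is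
   convex and closed, as Goursat's theorem asks, and avoids the point where f is only continuous. *)
pose H := [set w : C | re w <= ln s].
have Fp w : F (w + p) = F w by rewrite /F cexp_periodic.
have Hp w : H w -> H (w + p) by rewrite /H/= ReD /= addr0.
have Hexp w : H w -> 0 < cabs (z0 + cexp w - z0) < r.
  rewrite /H/= => Hw; rewrite addrC addKr cabs_cexp expR_gt0 /=.
  by apply: le_lt_trans sr; rewrite -[leRHS]lnK ?posrE// ler_expR.
have convH a b (t : R) : H a -> H b -> 0 <= t <= 1 -> H (segpt a b t).
  rewrite /H /= /segpt ReD ReZ ReB => Ha Hb /andP[t0 t1].
  have : (1 - t) * re a + t * re b <= (1 - t) * ln s + t * ln s.
    by apply: lerD; apply: ler_wpM2l => //; lra.
  by lra.
have closedH z : closure H z -> H z.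
  move=> /closure_cabsP Hz; rewrite /H/=; apply/ler_addgt0Pr => e e0.
  have [w Hw] := Hz _ e0; rewrite cabsC => wz.
  have := le_lt_trans (le_trans (ler_norm _) (Re_cabs (z - w))) wz.
  by move: Hw; rewrite /H /= ReB; lra.
have holoH z : H z -> exists d, has_cderiv F z d.
  move=> /Hexp/fd[d dP]; exists (d * (0 + cexp z)).
  apply: (@has_cderiv_comp _ (fun w => z0 + cexp w) f) dP.
  by apply: has_cderivD; [exact: has_cderiv_cst|exact: cexp_deriv].
have contF a b t : H a -> H b -> 0 <= t <= 1 -> ccont F (segpt a b t).
  by move=> Ha Hb t01; have [d /has_cderiv_cont] := holoH _ (convH _ _ _ Ha Hb t01).
(* Two triangles fill the parallelogram w, w + p, w' + p, w'; its sides w w' and (w + p)(w' + p)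
   cancel by periodicity. *)
have kE w w' : H w -> H w' -> segint F w (w + p) = segint F w' (w' + p).
  move=> Hw Hw'; have [Hwp Hwp'] := (Hp _ Hw, Hp _ Hw').
  have := Goursat convH closedH holoH Hw Hwp Hwp'.
  have := Goursat convH closedH holoH Hw Hwp' Hw'.
  rewrite (@segint_translate _ F w w'); [|by move=> t; exact: contF|exact: Fp].
  rewrite (@segint_rev _ F w' (w' + p)); last by move=> t; exact: contF.
  rewrite (@segint_rev _ F w w'); last by move=> t; exact: contF.
  rewrite (@segint_rev _ F w (w' + p)); last by move=> t; exact: contF.
  move=> h1 h2; apply/eqP; rewrite -subr_eq0 -(addr0 0) -{1}h1 -h2.
  by apply/eqP; ring.
have pE : cabs p = 2 * pi.
  rewrite /p /cabs /= expr0n add0r sqrtr_sqr ger0_norm//.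
  by rewrite mulr_ge0 ?pi_ge0.
have p0 : 0 < cabs p by rewrite pE mulr_gt0 ?pi_gt0.
have segp (a : R) t : re (segpt (a%:C : C) (a%:C + p) t) = a.
  by rewrite /segpt [_ + p - _]addrC addKr ReD ReZ /= mulr0 addr0.
have Hs : H ((ln s)%:C : C) by rewrite /H/=.
have bound : cabs (segint F (ln s)%:C ((ln s)%:C + p)) <= M * cabs p.
  have := @segint_approx _ F (ln s)%:C ((ln s)%:C + p) (fun=> 0) (fun=> 0) M.
  rewrite subrr subr0 [_ + p - _]addrC addKr; apply.
    by move=> t; apply: contF => //; exact: Hp.
  move=> t t01; split; first exact: has_cderiv_cst.
  rewrite subr0; apply: fM.
  by rewrite addrC addKr cabs_cexp segp lnK.
apply/ler_addgt0Pr => e e0; have [u u0 uP] := fc _ e0.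
(* Far to the left the vertical segment becomes a circle so small that f is within e of f(z0) on it,
   and the integral within e |p| of f(z0) p. *)
pose a := ln (Num.min u s / 2).
have us : 0 < Num.min u s by rewrite lt_min u0.
have us2 : 0 < Num.min u s / 2 by rewrite divr_gt0.
have Ha : H (a%:C : C).
  rewrite /H/= ler_ln ?posrE//; have : Num.min u s <= s by rewrite ge_min lexx orbT.
  by lra.
have := @segint_approx _ F a%:C (a%:C + p) (fun w => f z0 * w) (fun=> f z0) e.
rewrite -(kE _ _ Hs Ha) -mulrBr [_ + p - _]addrC addKr => le.
have {}le : cabs (segint F (ln s)%:C ((ln s)%:C + p) - f z0 * p) <= e * cabs p.
  apply: le; first by move=> t; apply: contF => //; exact: Hp.
  move=> t t01; split.
    by rewrite -[f z0 in X in has_cderiv _ _ X]mulr1; apply: has_cderivZ; exact: has_cderiv_id.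
  apply: ltW; apply: uP; rewrite addrC addKr cabs_cexp segp lnK ?posrE//.
  by have : Num.min u s <= u by [rewrite ge_min lexx]; lra.
rewrite -(ler_pM2r p0) mulrDl -cabsM.
rewrite (_ : f z0 * p = segint F (ln s)%:C ((ln s)%:C + p) -
   (segint F (ln s)%:C ((ln s)%:C + p) - f z0 * p)); last by ring.
by apply: le_trans (cabsB _ _) _; exact: lerD.
Qed.

(** The difference quotient at z0, given the value d there, is continuous at z0 and holomorphic
    elsewhere. On the circle of radius r / 2, inside the open disc where f is bounded, it is at most
    2 M / (r / 2). *)
Lemma Cauchy_estimate f z0 r M d : 0 < r ->
  (forall z, cabs (z - z0) < r -> exists d, has_cderiv f z d) ->
  (forall z, cabs (z - z0) < r -> cabs (f z) <= M) ->
  has_cderiv f z0 d -> cabs d <= 4 * M / r.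
Proof.
move=> r0 fd fM dP; pose q z := if z == z0 then d else (f z - f z0) / (z - z0).
have qz0 : q z0 = d by rewrite /q eqxx.
have z0r : cabs (z0 - z0) < r by rewrite subrr cabs0.
rewrite -qz0; apply: (@circle_mean_bound q z0 r (r / 2)); first by lra.
- move=> z /andP[]; rewrite cabs_gt0 subr_eq0 => zz0 /fd[d' d'P].
  have zz : 0 < cabs (z - z0) by rewrite cabs_gt0 subr_eq0.
  exists ((f z - f z0) * (- (1 - 0) / (z - z0) ^+ 2) + (z - z0)^-1 * (d' - 0)).
  apply: (@has_cderiv_near _ (fun z => (f z - f z0) / (z - z0)) _ _ _ _ zz).
    move=> w wz; rewrite /q; case: eqP => // wz0; move: wz.
    by rewrite wz0 cabsC ltxx.
  apply: has_cderivM; first by apply: has_cderivB => //; exact: has_cderiv_cst.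
  apply: has_cderivV; first by rewrite subr_eq0.
  by apply: has_cderivB; [exact: has_cderiv_id|exact: has_cderiv_cst].
- move=> e e0; have [s s0 sP] := dP _ (divr_gt0 e0 (ltr0Sn R 1)).
  exists s => // w wz; rewrite qz0 /q; case: eqP => [_|/eqP wz0].
    by rewrite subrr cabs0.
  have wz' : 0 < cabs (w - z0) by rewrite cabs_gt0 subr_eq0.
  rewrite (_ : _ - d = (f w - f z0 - d * (w - z0)) / (w - z0)).
    rewrite cabsM cabsV ltr_pdivrMr//; apply: le_lt_trans (sP _ wz) _.
    by rewrite ltr_pM2r//; lra.
  by field; rewrite subr_eq0.
- move=> z zE; have r2 : 0 < r / 2 by lra.
  have zz0 : z != z0 by rewrite -subr_eq0 -cabs_gt0 zE.
  rewrite /q (negbTE zz0) cabsM cabsV zE ler_pdivrMr//.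
  rewrite (_ : 4 * M / r * (r / 2) = M + M); last by field; exact: lt0r_neq0.
  by apply: le_trans (cabsB _ _) _; rewrite lerD ?fM// zE; lra.
Qed.

End CauchyEstimate.

(** * Holomorphic functions *)

Section Holomorphic.
Variable R : realType.
Local Notation C := (cplx R).
Implicit Types (f g h : C -> C) (x y z w : C) (r M K e : R).

Definition cball z r : set C := [set w | cabs (w - z) < r].

Definition holo (O : set C) f := forall z, O z -> derivable f z 1.

Lemma cball_sub x y r s : cabs (x - y) + s <= r -> cball x s `<=` cball y r.
Proof.
move=> le w /= wx; apply: le_lt_trans (cabs_dist x _ _) _.
by move: wx; rewrite /cball /=; lra.
Qed.

Lemma cball_center z r : 0 < r -> cball z r z.
Proof. by rewrite /cball /= subrr cabs0. Qed.

Lemma open_cball_sub (O : set C) z : open O -> O z ->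
  exists2 r : R, 0 < r & cball z r `<=` O.
Proof. by move=> /open_cabsP oO /oO. Qed.

Lemma holo_sub (O O' : set C) f : O `<=` O' -> holo O' f -> holo O f.
Proof. by move=> OO' hf z /OO'; exact: hf. Qed.

Lemma cball_segpt z r x y (t : R) : cball z r x -> cball z r y ->
  0 <= t <= 1 -> cball z r (segpt x y t).
Proof.
rewrite /cball /= => xz yz /andP[t0 t1].
rewrite (_ : _ - z = (1 - t)%:C * (x - z) + t%:C * (y - z)); last first.
  by rewrite /segpt rmorphB rmorph1; ring.
apply: le_lt_trans (cabsD _ _) _; rewrite !cabsM !cabs_real.
rewrite (ger0_norm t0) ger0_norm ?subr_ge0//.
have [->|tn0] := eqVneq t 0; first by rewrite subr0 mul1r mul0r addr0.
have : (1 - t) * cabs (x - z) <= (1 - t) * r.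
  by rewrite ler_wpM2l ?subr_ge0// ltW.
have : t * cabs (y - z) < t * r by rewrite ltr_pM2l// lt_def tn0.
by lra.
Qed.

Lemma complex_mean_value f x y (l : C) K :
  (forall t, 0 <= t <= 1 -> derivable f (segpt x y t) 1 /\
     cabs ('D_1 f (segpt x y t) - l) <= K) ->
  cabs (f y - f x - l * (y - x)) <= K * cabs (y - x).
Proof.
move=> fK; have := @curve_mean_value _
  (fun t => f (segpt x y t) - l * segpt x y t)
  (fun t => 'D_1 f (segpt x y t) * (y - x) - l * (y - x)) (K * cabs (y - x)).
rewrite segpt0 segpt1.
rewrite (_ : f y - _ - _ = f y - f x - l * (y - x)); last by ring.
apply => t t01; have [/derivable_has_cderiv df le] := fK t t01; split.
  have line : has_rderiv (segpt x y) t (y - x) by exact: has_rderiv_line.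
  apply: has_rderivB; first exact: has_rderiv_comp df.
  apply: (@has_rderiv_comp _ (fun z => l * z)) line _.
  by rewrite -[X in has_cderiv _ _ X]mulr1; apply: has_cderivZ; exact: has_cderiv_id.
by rewrite -mulrBl cabsM ler_wpM2r ?cabs_ge0.
Qed.

Lemma Cauchy_derive f z r M : 0 < r -> holo (cball z r) f ->
  (forall w, cball z r w -> cabs (f w) <= M) -> cabs ('D_1 f z) <= 4 * M / r.
Proof.
move=> r0 hf fM; apply: (Cauchy_estimate r0 _ fM).
  by move=> w /hf/derivable_has_cderiv; exists ('D_1 f w).
by apply: derivable_has_cderiv; apply: hf; exact: cball_center.
Qed.

Lemma deriveB_cplx f g z : derivable f z 1 -> derivable g z 1 ->
  derivable (fun w => f w - g w) z 1 /\
  'D_1 (fun w => f w - g w) z = 'D_1 f z - 'D_1 g z.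
Proof.
move=> /derivable_has_cderiv fd /derivable_has_cderiv gd.
by apply/has_cderivP; exact: has_cderivB.
Qed.

(* If |Re f| <= e then 1 / (2 e + i Im f(z) - f) is bounded by 1 / e. *)
Lemma Cauchy_real_part f z r e : 0 < r -> 0 < e -> holo (cball z r) f ->
  (forall w, cball z r w -> `|re (f w)| <= e) -> cabs ('D_1 f z) <= 36 * e / r.
Proof.
move=> r0 e0 hf fe; pose c : C := (2 * e) +i* im (f z).
have reg w : cball z r w -> e <= cabs (c - f w).
  move=> /fe fwe; apply: le_trans (le_trans (ler_norm _) (Re_cabs _)).
  by rewrite ReB /=; have := ler_norm (re (f w)); lra.
have nz w : cball z r w -> c - f w != 0.
  by move=> /reg h; rewrite -cabs_gt0; apply: lt_le_trans h.
have dG w : cball z r w ->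
    has_cderiv (fun w => (c - f w)^-1) w (- (0 - 'D_1 f w) / (c - f w) ^+ 2).
  move=> wz; apply: (@has_cderivV _ (fun w => c - f w)); first exact: nz.
  apply: has_cderivB; first exact: has_cderiv_cst.
  by apply: derivable_has_cderiv; exact: hf.
have zz := cball_center z r0.
have : cabs (- (0 - 'D_1 f z) / (c - f z) ^+ 2) <= 4 * e^-1 / r.
  apply: (Cauchy_estimate r0 _ _ (dG z zz)) => w wz; first by eexists; exact: dG.
  by rewrite cabsV lef_pV2 ?posrE ?(lt_le_trans e0)// reg.
rewrite sub0r opprK cabsM cabsV cabsX.
have le3 : cabs (c - f z) <= 3 * e.
  apply: le_trans (cabs_ReIm _) _; rewrite ReB ImB /= subrr normr0 addr0.
  apply: le_trans (ler_normB _ _) _; rewrite ger0_norm; last by lra.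
  by have := fe z zz; lra.
have n0 : 0 < cabs (c - f z) by rewrite cabs_gt0 nz.
rewrite ler_pdivrMr ?exprn_gt0// => h; apply: le_trans h _.
have -> : 36 * e / r = 4 * e^-1 / r * (3 * e) ^+ 2.
  by field; rewrite !lt0r_neq0.
apply: ler_wpM2l; first by rewrite ?divr_ge0 ?mulr_ge0 ?invr_ge0 ?ltW.
apply: lerXn2r => //; rewrite nnegrE ?cabs_ge0//.
by rewrite mulr_ge0// ltW.
Qed.

(** Up to sign, the real parts of f - g and i (f + g) are the real and imaginary parts of f - conj
    g, hence small; f' is half the sum of (f - g)' and (f + g)'. This disposes of the
    orientation-reversing similarities. *)
Lemma Cauchy_conj f g z r e : 0 < r -> 0 < e ->
  holo (cball z r) f -> holo (cball z r) g ->
  (forall w, cball z r w -> cabs (f w - conjc (g w)) <= e) ->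
  cabs ('D_1 f z) <= 36 * e / r.
Proof.
move=> r0 e0 hf hg fg; have zz := cball_center z r0.
pose ii : C := 0 +i* 1.
have dP w : cball z r w -> has_cderiv (fun w => f w - g w) w ('D_1 f w - 'D_1 g w).
  by move=> wz; apply: has_cderivB; apply: derivable_has_cderiv; [exact: hf|exact: hg].
have dM w : cball z r w ->
    has_cderiv (fun w => ii * (f w + g w)) w (ii * ('D_1 f w + 'D_1 g w)).
  move=> wz; apply: has_cderivZ.
  by apply: has_cderivD; apply: derivable_has_cderiv; [exact: hf|exact: hg].
have h1 : cabs ('D_1 f z - 'D_1 g z) <= 36 * e / r.
  have := @Cauchy_real_part (fun w => f w - g w) z r e r0 e0.
  rewrite (has_cderiv_derive (dP z zz)); apply; first by move=> w /dP/has_cderiv_derivable.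
  move=> w /fg; apply: le_trans; apply: le_trans (Re_cabs _).
  by rewrite !ReB; case: (g w).
have h2 : cabs ('D_1 f z + 'D_1 g z) <= 36 * e / r.
  have := @Cauchy_real_part (fun w => ii * (f w + g w)) z r e r0 e0.
  rewrite (has_cderiv_derive (dM z zz)) cabsM [cabs ii](_ : _ = 1); last first.
    by rewrite /cabs /= expr0n expr1n add0r sqrtr1.
  rewrite mul1r; apply; first by move=> w /dM/has_cderiv_derivable.
  move=> w /fg; apply: le_trans; apply: le_trans (Im_cabs _).
  rewrite ImB; case: (f w) (g w) => [a b] [a' b'] /=.
  by rewrite mul0r mul1r sub0r normrN opprK.
have halfsum (a b : C) : a = ((a - b) + (a + b)) * (2^-1)%:C.
  by rewrite fmorphV rmorph_nat; field.
rewrite [X in cabs X](halfsum _ ('D_1 g z)).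
rewrite cabsM cabs_real ger0_norm; last by lra.
have := le_trans (cabsD _ _) (lerD h1 h2); lra.
Qed.

(** Cauchy estimates for differences of the approximants make their derivatives converge; letting
    one approximant tend to g, the increments of h_k - g are bounded by a small multiple of |w -
    z|. *)
Lemma holo_limit g z r : 0 < r ->
  (forall e, 0 < e -> exists h, holo (cball z r) h /\
     forall w, cball z r w -> cabs (h w - g w) <= e) ->
  derivable g z 1.
Proof.
move=> r0 gh; have zz := cball_center z r0.
have half : 0 <= (2^-1 : R) < 1 by lra.
have p0 k : 0 < 2^-1 ^+ k :> R by rewrite exprn_gt0// invr_gt0.
have [h hP] : exists h : nat -> C -> C, forall k, holo (cball z r) (h k) /\
     forall w, cball z r w -> cabs (h k w - g w) <= 2^-1 ^+ k.
  by have [h hP] := choice (fun k => gh _ (p0 k)); exists h.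
(* Cauchy's bound on discs of radius r / 2 for a difference of two approximants, each within 2^-k of
   g. *)
pose b k : R := 4 * (2 * 2^-1 ^+ k) / (r / 2).
have bE w k l : cball z (r / 2) w -> (k <= l)%N ->
    cabs ('D_1 (h k) w - 'D_1 (h l) w) <= b k.
  move=> wz kl; have sub : cball w (r / 2) `<=` cball z r.
    by apply: cball_sub; move: wz; rewrite /cball /=; lra.
  have [hk hl] := (hP k, hP l).
  have ww : cball z r w by apply: sub; apply: cball_center; lra.
  rewrite -(deriveB_cplx (hk.1 w ww) (hl.1 w ww)).2.
  apply: Cauchy_derive; first by lra.
    by move=> v /sub vz; have [] := deriveB_cplx (hk.1 v vz) (hl.1 v vz).
  move=> v /sub vz; rewrite (_ : _ - _ = (h k v - g v) - (h l v - g v)); last by ring.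
  apply: le_trans (cabsB _ _) _; have := hk.2 v vz; have := hl.2 v vz.
  have : 2^-1 ^+ l <= 2^-1 ^+ k :> R.
    by apply: ler_wiXn2l => //; lra.
  by lra.
have [|d dP] := @complex_tail_limit _ (fun k => 'D_1 (h k) z) b.
  by move=> n m nm; apply: bE => //; apply: cball_center; lra.
have incr w k : cball z (r / 2) w ->
    cabs ((h k w - g w) - (h k z - g z)) <= b k * cabs (w - z).
  move=> wz; have wr : cball z r w by move: wz; rewrite /cball /=; lra.
  apply/ler_addgt0Pr => e e0; have [l lP] := expr_small_mul 2 half e0.
  pose m := maxn k l.
  have hm v : cball z r v -> cabs (h m v - g v) <= e / 2.
    move=> vz; apply: le_trans ((hP m).2 v vz) _.
    have : 2^-1 ^+ m <= 2^-1 ^+ l :> R.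
      by apply: ler_wiXn2l; [lra|lra|exact: leq_maxr].
    by lra.
  have : cabs ((h k w - h m w) - (h k z - h m z) - 0 * (w - z)) <=
      b k * cabs (w - z).
    apply: (@complex_mean_value (fun v => h k v - h m v)) => t t01.
    have tz : cball z (r / 2) (segpt z w t).
      by apply: cball_segpt => //; apply: cball_center; lra.
    have tr : cball z r (segpt z w t) by move: tz; rewrite /cball /=; lra.
    have [dB ->] := deriveB_cplx ((hP k).1 _ tr) ((hP m).1 _ tr).
    by rewrite subr0; split => //; apply: bE => //; exact: leq_maxl.
  rewrite mul0r subr0 => le.
  rewrite (_ : _ - _ = (h k w - h m w - (h k z - h m z)) +
    ((h m w - g w) - (h m z - g z))); last by ring.
  apply: le_trans (cabsD _ _) _; apply: lerD => //.
  apply: le_trans (cabsB _ _) _.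
  by have := hm _ wr; have := hm _ zz; lra.
apply: (@has_cderiv_derivable _ _ _ d) => e e0.
have e4 : 0 < e / 2 by lra.
(* Of the factor 3, one b k comes from the increments of h_k - g and two from the distance of
   h_k'(z) to the limit d. *)
have [k kP] := expr_small_mul (3 * (4 * 2 / (r / 2))) half e4.
have [s s0 sP] := derivable_has_cderiv ((hP k).1 z zz) e4.
exists (Num.min s (r / 2)) => [|w]; first by rewrite lt_min s0; lra.
rewrite lt_min => /andP[/sP h1 /(incr w k) h2].
rewrite (_ : g w - _ - _ = (h k w - h k z - 'D_1 (h k) z * (w - z)) -
  ((h k w - g w) - (h k z - g z)) + ('D_1 (h k) z - d) * (w - z)); last by ring.
apply: le_trans (cabsD _ _) _; rewrite cabsM.
apply: le_trans (lerD (cabsB _ _) (ler_wpM2r (cabs_ge0 _) (dP k))) _.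
have : 3 * b k * cabs (w - z) <= e / 2 * cabs (w - z).
  by rewrite ler_wpM2r ?cabs_ge0// ltW// /b; move: kP; lra.
lra.
Qed.

(** The existence of f'' is what this prepares, so f'' cannot be used. Instead the Cauchy estimate
    is applied to x |-> f (x + h) - f x with h = w' - w, of size at most 8 M |h| / r by the mean
    value inequality. *)
Lemma derive_lipschitz f z r M : 0 < r -> holo (cball z r) f ->
  (forall w, cball z r w -> cabs (f w) <= M) ->
  forall w w', cball z (r / 4) w -> cball z (r / 4) w' ->
  cabs ('D_1 f w' - 'D_1 f w) <= 128 * M / r ^+ 2 * cabs (w' - w).
Proof.
move=> r0 hf fM w w' wz wz'; have rn0 := lt0r_neq0 r0.
have bd v : cball z (r / 2) v -> cabs ('D_1 f v) <= 8 * M / r.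
  move=> vz; have sub : cball v (r / 2) `<=` cball z r.
    by apply: cball_sub; move: vz; rewrite /cball /=; lra.
  rewrite (_ : 8 * M / r = 4 * M / (r / 2)); last by field.
  apply: Cauchy_derive; [by lra|exact: holo_sub hf|by move=> x /sub/fM].
pose k x := f (x + (w' - w)) - f x.
have shift_in v : cball w (r / 4) v ->
    cball z (r / 2) v /\ cball z (r / 2) (v + (w' - w)).
  move=> vw; split.
    by apply: (cball_sub _ vw); move: wz; rewrite /cball /=; lra.
  apply: (@cball_sub w' _ _ (r / 4)); first by move: wz'; rewrite /cball /=; lra.
  rewrite /cball /= (_ : _ - _ = v - w); last by ring.
  exact: vw.
have hfr v : cball z (r / 2) v -> derivable f v 1.
  by move=> vz; apply: hf; move: vz; rewrite /cball /=; lra.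
have dk v : cball w (r / 4) v ->
    has_cderiv k v ('D_1 f (v + (w' - w)) * (1 + 0) - 'D_1 f v).
  move=> /shift_in[v1 v2]; apply: has_cderivB; last exact/derivable_has_cderiv/hfr.
  apply: (@has_cderiv_comp _ (fun x => x + (w' - w)) f); last exact/derivable_has_cderiv/hfr.
  by apply: has_cderivD; [exact: has_cderiv_id|exact: has_cderiv_cst].
have ww : cball w (r / 4) w by apply: cball_center; lra.
have -> : 'D_1 f w' - 'D_1 f w = 'D_1 k w.
  rewrite (has_cderiv_derive (dk w ww)) addr0 mulr1.
  by rewrite (_ : w + (w' - w) = w') //; ring.
rewrite (_ : 128 * _ / _ * _ = 4 * (8 * M / r * cabs (w' - w)) / (r / 4)); last by field.
apply: Cauchy_derive; first by lra.
  by move=> v /dk/has_cderiv_derivable.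
move=> v /shift_in[v1 v2].
have := @complex_mean_value f v (v + (w' - w)) 0 (8 * M / r).
rewrite mul0r subr0 (_ : v + _ - v = w' - w); last by ring.
apply => t t01; have tz := cball_segpt v1 v2 t01.
by rewrite subr0; split; [exact: hfr|exact: bd].
Qed.

Lemma ccont_bounded f z : ccont f z -> exists2 r : R, 0 < r &
  forall w, cball z r w -> cabs (f w) <= cabs (f z) + 1.
Proof.
move=> /(_ _ ltr01)[r r0 rP]; exists r => // w /rP h.
have := cabsD (f w - f z) (f z); rewrite subrK; lra.
Qed.

Lemma derivable_ccont f z : derivable f z 1 -> ccont f z.
Proof. by move=> /derivable_has_cderiv/has_cderiv_cont. Qed.

(** By the Lipschitz bound, f' is a uniform limit of difference quotients of f with a fixed real
    step, and these are holomorphic. *)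
Theorem derive_derivable f z r : 0 < r -> holo (cball z r) f ->
  derivable ('D_1 f) z 1.
Proof.
move=> r0 hf.
have [s s0 fM] := ccont_bounded (derivable_ccont (hf _ (cball_center z r0))).
set M := _ + 1 in fM; have M0 : 0 <= M by rewrite addr_ge0 ?cabs_ge0.
wlog rs : r r0 hf / r <= s.
  move=> wl; apply: (wl (Num.min r s)); first by rewrite lt_min r0.
    by apply: holo_sub hf => w; rewrite /cball /= lt_min => /andP[].
  by rewrite ge_min lexx orbT.
have {fM rs s s0}fM w : cball z r w -> cabs (f w) <= M.
  by move=> wz; apply: fM; apply: lt_le_trans rs.
have lip := derive_lipschitz r0 hf fM; set K := 128 * M / r ^+ 2 in lip.
have K0 : 0 <= K by rewrite divr_ge0 ?mulr_ge0 ?exprn_ge0// ltW.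
apply: (@holo_limit _ z (r / 8)); first by lra.
move=> e e0; pose d := Num.min (r / 8) (e / (K + 1)).
have K1 : 0 < K + 1 by lra.
have d0 : 0 < d by rewrite lt_min divr_gt0//= divr_gt0.
have dr : d <= r / 8 by rewrite /d ge_min lexx.
have de : K * d <= e.
  have : d <= e / (K + 1) by rewrite /d ge_min lexx orbT.
  by rewrite ler_pdivlMr//; lra.
have dC : (d%:C : C) != 0 by rewrite -cabs_gt0 cabs_real gtr0_norm.
have cd : cabs (d%:C : C) = d by rewrite cabs_real gtr0_norm.
have inb w : cball z (r / 8) w -> cball z (r / 4) w /\ cball z (r / 4) (w + d%:C).
  rewrite /cball /= => wz; split; first by lra.
  rewrite (_ : _ - z = (w - z) + d%:C); last by ring.
  by apply: le_lt_trans (cabsD _ _) _; rewrite cd; lra.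
have hfr v : cball z (r / 4) v -> derivable f v 1.
  by move=> vz; apply: hf; move: vz; rewrite /cball /=; lra.
exists (fun w => d%:C^-1 * (f (w + d%:C) - f w)); split.
  move=> w /inb[w1 w2].
  apply: (@has_cderiv_derivable _ _ _ (d%:C^-1 * ('D_1 f (w + d%:C) * (1 + 0) - 'D_1 f w))).
  apply: has_cderivZ; apply: has_cderivB; last exact/derivable_has_cderiv/hfr.
  apply: (@has_cderiv_comp _ (fun x => x + d%:C) f); last exact/derivable_has_cderiv/hfr.
  by apply: has_cderivD; [exact: has_cderiv_id|exact: has_cderiv_cst].
move=> w /inb[w1 w2].
have : cabs (f (w + d%:C) - f w - 'D_1 f w * (w + d%:C - w)) <=
    K * d * cabs (w + d%:C - w).
  apply: complex_mean_value => t t01; have tz := cball_segpt w1 w2 t01.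
  split; first exact: hfr.
  apply: le_trans (lip _ _ w1 tz) _; rewrite ler_wpM2l//.
  rewrite (_ : _ - w = t%:C * d%:C); last by rewrite /segpt; ring.
  rewrite cabsM cd cabs_real; case/andP: t01 => t0 t1.
  by rewrite ger0_norm// ler_piMl// ltW.
rewrite (_ : w + _ - w = d%:C); last by ring.
move=> h; rewrite (_ : _ - _ = d%:C^-1 * (f (w + d%:C) - f w - 'D_1 f w * d%:C)).
  by rewrite cabsM cabsV cd ler_pdivrMl// [leRHS]mulrC; apply: le_trans h _; rewrite cd ler_wpM2r// ltW.
by field.
Qed.

Lemma holo_derive (O : set C) f : open O -> holo O f -> holo O ('D_1 f).
Proof.
move=> oO hf z /(open_cball_sub oO)[r r0 rO].
by apply: (derive_derivable r0); exact: holo_sub hf.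
Qed.

End Holomorphic.

(** * The identity theorem *)

Section IdentityTheorem.
Variable R : realType.
Local Notation C := (cplx R).
Implicit Types (f g h : C -> C) (x y z w : C) (r M K e : R).

Definition derives n f : C -> C := iter n (fun g => 'D_1 g) f.

Lemma derivesS n f : derives n.+1 f = 'D_1 (derives n f).
Proof. by []. Qed.

Lemma derivesSr n f : derives n.+1 f = derives n ('D_1 f).
Proof. exact: iterSr. Qed.

Lemma open_cball z r : open (cball z r).
Proof.
apply/open_cabsP => w wz; exists (r - cabs (w - z)); first by rewrite subr_gt0.
move=> v vw; rewrite /cball /=; apply: le_lt_trans (cabs_dist w _ _) _.
by move: vw wz; rewrite /cball /=; lra.
Qed.

Lemma holo_derives n (O : set C) f : open O -> holo O f -> holo O (derives n f).
Proof.
move=> oO hf; elim: n => [|n IH]; first exact: hf.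
by rewrite derivesS; exact: holo_derive.
Qed.

(** Flatness passes to g', and a bound of order n on g' becomes one of order n + 1 on g by the mean
    value inequality along the segment from y. *)
Lemma flat_order g y r n : 0 < r -> holo (cball y r) g ->
  (forall k, derives k g y = 0) ->
  exists2 K : R, 0 <= K & exists2 s : R, 0 < s &
    forall w, cball y s w -> cabs (g w) <= K * cabs (w - y) ^+ n.
Proof.
move=> r0; elim: n g => [|n IH] g hg dg.
  have [s s0 sP] := ccont_bounded (derivable_ccont (hg _ (cball_center y r0))).
  exists (cabs (g y) + 1); first by rewrite addr_ge0 ?cabs_ge0.
  by exists s => // w /sP; rewrite expr0 mulr1.
have [||K K0 [s s0 sP]] := IH ('D_1 g).
- by apply: holo_derive hg; exact: open_cball.
- by move=> k; rewrite -derivesSr.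
exists K => //; exists (Num.min r s) => [|w]; first by rewrite lt_min r0.
rewrite /cball /= lt_min => /andP[wr ws].
have := @complex_mean_value _ g y w 0 (K * cabs (w - y) ^+ n).
have gy : g y = 0 by exact: (dg 0).
rewrite mul0r subr0 gy subr0 -mulrA -exprSr; apply => t t01.
rewrite subr0; split.
  by apply: hg; apply: cball_segpt => //; exact: cball_center.
apply: le_trans (sP _ _) _; first by apply: cball_segpt => //; exact: cball_center.
rewrite ler_wpM2l// lerXn2r// ?nnegrE ?cabs_ge0//.
rewrite /segpt (_ : _ - y = t%:C * (w - y)); last by ring.
case/andP: t01 => t0 t1.
by rewrite cabsM cabs_real ger0_norm// ler_piMl ?cabs_ge0.
Qed.

(* The functions g / (z - y)^n are holomorphic for every n, so the mean value
   bound on circles inside the annulus r/2 <= |z - y| < r makes |g| smaller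
   than any M / 4^n near y. *)
Lemma flat_zero g y r M : 0 < r -> holo (cball y r) g ->
  (forall w, cball y r w -> cabs (g w) <= M) ->
  (forall k, derives k g y = 0) ->
  forall z, cball y (r / 8) z -> g z = 0.
Proof.
move=> r0 hg gM dg z zy.
have gy : g y = 0 by exact: (dg 0).
have M0 : 0 <= M.
  by apply: le_trans (gM y (cball_center y r0)); exact: cabs_ge0.
have r2 : 0 < r / 2 by lra.
have bd n : cabs (g z) <= M * (4^-1) ^+ n.
  pose h w := if w == y then 0 else g w / (w - y) ^+ n.
  have hd w : cball y r w -> exists d, has_cderiv h w d.
    move=> wy; have [->|wny] := eqVneq w y.
      (* Two orders beyond n leave a quotient of order |v - y|^2, hence with derivative 0 at y. *)
      have [K K0 [s s0 sP]] := flat_order n.+2 r0 hg dg.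
      exists 0 => e e0; have K1 : 0 < K + 1 by lra.
      exists (Num.min s (e / (K + 1))) => [|v].
        by rewrite lt_min s0 divr_gt0.
      rewrite lt_min ltr_pdivlMr// => /andP[/sP h1 h2].
      rewrite mul0r subr0 /h eqxx subr0; case: eqP => [->|/eqP vy].
        by rewrite cabs0 subrr cabs0 mulr0.
      have vy0 : 0 < cabs (v - y) by rewrite cabs_gt0 subr_eq0.
      rewrite cabsM cabsV cabsX ler_pdivrMr ?exprn_gt0//.
      apply: le_trans h1 _; rewrite !exprS -[leRHS]mulrA mulrA.
      apply: ler_pM; rewrite ?mulr_ge0 ?exprn_ge0 ?cabs_ge0//.
      by have := cabs_ge0 (v - y); lra.
    have wy0 : 0 < cabs (w - y) by rewrite cabs_gt0 subr_eq0.
    have [d1 d1P] : exists d, has_cderiv (fun v => (v - y) ^+ n) w d.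
      exists (n%:R * (w - y) ^+ n.-1 * (1 - 0)); apply: has_cderivX.
      by apply: has_cderivB; [exact: has_cderiv_id|exact: has_cderiv_cst].
    have := has_cderivV _ d1P; rewrite expf_neq0 ?subr_eq0// => /(_ isT) d2P.
    have /derivable_has_cderiv gd := hg _ wy.
    eexists; apply: (has_cderiv_near wy0) (has_cderivM gd d2P) => v vw.
    rewrite /h; case: eqP => // vy; move: vw; rewrite vy cabsC ltxx //.
  have hz : cabs (h z) <= M / (r / 2) ^+ n.
    move: zy; rewrite /cball /= => zy.
    (* As |z - y| < r / 8, the circle of radius 5 r / 8 about z stays at distance at least r / 2
       from y, and the disc of radius 7 r / 8 inside the given one. *)
    apply: (@circle_mean_bound _ h z (7 / 8 * r) (5 / 8 * r)); first by lra.
    - move=> w /andP[_ wz]; apply: hd; rewrite /cball /=.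
      by apply: le_lt_trans (cabs_dist z _ _) _; lra.
    - have [|d /has_cderiv_cont//] := hd z.
      by rewrite /cball /=; lra.
    - move=> w wz; have w1 : cabs (w - y) < r.
        by apply: le_lt_trans (cabs_dist z _ _) _; lra.
      have w2 : r / 2 <= cabs (w - y).
        by have := cabs_dist y w z; rewrite wz (cabsC y z); lra.
      rewrite /h; case: eqP => [wy|_].
        by move: w2; rewrite wy subrr cabs0; lra.
      rewrite cabsM cabsV cabsX; apply: ler_pM; rewrite ?cabs_ge0 ?invr_ge0//.
      + by rewrite exprn_ge0 ?cabs_ge0.
      + exact: gM.
      + rewrite lef_pV2 ?posrE ?exprn_gt0//; last by lra.
        by rewrite lerXn2r// nnegrE; lra.
  have [zy0|zny] := eqVneq z y.
    by rewrite zy0 gy cabs0 mulr_ge0// exprn_ge0// invr_ge0.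
  have zy0 : 0 < cabs (z - y) by rewrite cabs_gt0 subr_eq0.
  move: hz; rewrite /h (negbTE zny) cabsM cabsV cabsX ler_pdivrMr ?exprn_gt0//.
  move=> h1; apply: le_trans h1 _; rewrite -mulrA -exprVn -exprMn.
  rewrite ler_wpM2l// lerXn2r// ?nnegrE ?mulr_ge0 ?cabs_ge0 ?invr_ge0//; first lra.
  by rewrite ler_pdivrMl//; move: zy; rewrite /cball /=; lra.
apply/eqP; rewrite -cabs_eq0 eq_le cabs_ge0 andbT.
apply/ler_addgt0Pr => e e0; rewrite add0r.
have q : 0 <= (4^-1 : R) < 1 by lra.
by have [n /ltW] := expr_small_mul M q e0; exact: le_trans.
Qed.

Lemma derives_zero g (O : set C) n : open O -> (forall z, O z -> g z = 0) ->
  forall z, O z -> derives n g z = 0.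
Proof.
move=> oO gO; elim: n => // n IH z Oz.
have [r r0 rO] := open_cball_sub oO Oz; apply: has_cderiv_derive.
apply: (has_cderiv_near r0) (has_cderiv_cst z (0 : C)) => w /rO wO.
exact/esym/IH.
Qed.

(** The set of points where all derivatives vanish is open by [flat_zero] and relatively closed by
    continuity of the derivatives. *)
Theorem identity_theorem g (O : set C) x : open O -> connected O ->
  holo O g -> O x -> (forall n, derives n g x = 0) ->
  forall z, O z -> g z = 0.
Proof.
move=> oO cO hg Ox gx; pose Z := [set y | O y /\ forall n, derives n g y = 0].
suff ZO : Z = O by move=> z; rewrite -ZO => -[_ /(_ 0)].
have oZ : open Z.
  apply/open_cabsP => y [Oy gy].
  have [r r0 rO] := open_cball_sub oO Oy.
  have [s s0 sP] := ccont_bounded (derivable_ccont (hg _ Oy)).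
  pose t := Num.min r s; have t0 : 0 < t by rewrite lt_min r0.
  have tr : t <= r by rewrite /t ge_min lexx.
  have ts : t <= s by rewrite /t ge_min lexx orbT.
  have zero := @flat_zero g y t _ t0 _ _ gy.
  exists (t / 8) => [|w wy]; first by lra.
  have {}zero : forall z, cball y (t / 8) z -> g z = 0.
    apply: zero => [v vt|v vt]; first by apply: hg; apply: rO; apply: lt_le_trans tr.
    by apply: sP; exact: lt_le_trans ts.
  split; first by apply: rO; rewrite /cball /=; lra.
  by move=> n; have := @derives_zero g (cball y (t / 8)) n; apply => //; exact: open_cball.
apply: cO; first by exists x.
- by exists Z => //; rewrite setIC; apply/esym/setIidPl => y [].
- exists (closure Z); first exact: closed_closure.
  apply/seteqP; split=> [y Zy|y [Oy /closure_cabsP cy]].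
    by split; [case: Zy|exact: subset_closure].
  split=> // n; apply/eqP; rewrite -cabs_eq0 eq_le cabs_ge0 andbT.
  apply/ler_addgt0Pr => e e0; rewrite add0r.
  have [r r0 rP] := derivable_ccont (@holo_derives n _ _ oO hg _ Oy) e0.
  have [w [_ /(_ n) wn] /rP] := cy _ r0.
  by rewrite wn sub0r cabsN => /ltW.
Qed.

End IdentityTheorem.

(** * Compactness *)

Section UltrafilterCompactness.
Variable R : realType.
Local Notation C := (cplx R).

(** One ultrafilter provides limits of words, letters and points simultaneously, in place of
    successive extractions of subsequences. *)
Lemma nat_ultrafilter : exists U : set_system nat,
  UltraFilter U /\ forall m, U [set n | (m <= n)%N].
Proof.
have [U [uU sub]] := ultraFilterLemma (@eventually_filter).
by exists U; split => // m; apply: sub; exists m.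
Qed.

Variables (U : set_system nat) (uU : UltraFilter U).

Lemma ultra_const (T : finType) (x : nat -> T) : exists t, U [set n | x n = t].
Proof.
have pU := @ultra_proper _ _ uU.
have [//|nU] := pselect (exists t, U [set n | x n = t]); exfalso.
have : U [set n | forall t, x n <> t].
  apply: (@filter_forall nat T (fun t n => x n <> t)) => t.
  by have [Ut|//] := in_ultra_setVsetC [set n | x n = t] uU; case: nU; exists t.
by move=> /filter_ex[n /(_ (x n))].
Qed.

Lemma ultra_real_limit (M : R) (x : nat -> R) : (forall n, `|x n| <= M) ->
  exists l, forall e : R, 0 < e -> U [set n | `|x n - l| < e].
Proof.
have pU := @ultra_proper _ _ uU.
move=> xM; have F1 : (x @ U) `[- M, M]%classic.
  apply: (@filterE _ U _ _) => n /=; have := xM n.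
  by rewrite ler_norml in_itv.
have [l [_ lF]] := @segment_compact R (- M) M (x @ U) _ F1.
exists l => e e0.
have [//|nU] := in_ultra_setVsetC [set n | `|x n - l| < e] uU.
have [||y []] := lF [set y | ~ (`|y - l| < e)] [set y | `|y - l| < e].
- exact: nU.
- by apply/nbhs_ballP; exists e => // y; rewrite /ball/= distrC.
- by [].
Qed.

Lemma ultra_complex_limit (M : R) (x : nat -> C) : (forall n, cabs (x n) <= M) ->
  exists l, forall e : R, 0 < e -> U [set n | cabs (x n - l) < e].
Proof.
have pU := @ultra_proper _ _ uU.
move=> xM.
have [n|p pP] := @ultra_real_limit M (fun n => re (x n)).
  by apply: le_trans (xM n); exact: Re_cabs.
have [n|q qP] := @ultra_real_limit M (fun n => im (x n)).
  by apply: le_trans (xM n); exact: Im_cabs.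
exists (p +i* q) => e e0; have e2 : 0 < e / 2 by rewrite divr_gt0.
apply: filterS (filterI (pP _ e2) (qP _ e2)) => n [/= h1 h2].
apply: le_lt_trans (cabs_ReIm _) _.
by rewrite ReB ImB [ltRHS]splitr ltrD.
Qed.

End UltrafilterCompactness.

(** * Uniform constants on compact sets *)

Section CompactUniformity.
Variable R : realType.
Local Notation C := (cplx R).

Lemma harmonic_small (e : R) : 0 < e -> exists m, forall n, (m <= n)%N ->
  n.+1%:R^-1 < e.
Proof.
move=> e0; exists (Num.bound e^-1) => n mn.
rewrite invf_plt ?posrE//; apply: lt_le_trans (archi_boundP _) _.
  by rewrite invr_ge0 ltW.
by rewrite ler_nat ltnW// ltnS.
Qed.

Lemma bounded_closure (A : set C) : bounded_set A ->
  exists M : R, forall z, closure A z -> cabs z <= M.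
Proof.
move=> /bounded_cabs[M MA]; exists M => z /closure_cabsP cz.
apply/ler_addgt0Pr => e e0; have [w /MA Aw wz] := cz _ e0.
have := cabsD (z - w) w; rewrite subrK cabsC; lra.
Qed.

(** Otherwise points violating P at 1 / (n + 1) would have a limit in the closure, and the local
    constant there would contradict monotonicity. *)
Lemma compact_uniform (A : set C) (P : R -> C -> Prop) : bounded_set A ->
  (forall c c' z, c' <= c -> P c z -> P c' z) ->
  (forall z, closure A z -> exists2 c, 0 < c & exists2 r : R, 0 < r &
     forall w, closure A w -> cabs (w - z) < r -> P c w) ->
  exists2 c, 0 < c & forall z, closure A z -> P c z.
Proof.
move=> /bounded_closure[M AM] mono loc.
have [//|nP] := pselect (exists2 c, 0 < c & forall z, closure A z -> P c z).
exfalso; have bad n : exists z, closure A z /\ ~ P (n.+1%:R^-1) z.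
  have [//|nz] := pselect (exists z, closure A z /\ ~ P (n.+1%:R^-1) z).
  exfalso; apply: nP; exists n.+1%:R^-1; first by rewrite invr_gt0.
  by move=> z Az; apply: contrapT => nPz; apply: nz; exists z.
have [x xP] := choice bad; have [U [uU U8]] := nat_ultrafilter.
have pU := @ultra_proper _ _ uU.
have [n|z zP] := @ultra_complex_limit R U uU M x; first by apply: AM; case: (xP n).
have Az : closure A z.
  apply: closed_closure; apply/closure_cabsP => d d0.
  by have [n xn] := filter_ex (zP _ d0); exists (x n); case: (xP n).
have [c c0 [r r0 rP]] := loc _ Az; have [m mP] := harmonic_small c0.
have [n [/= h1 /mP h2]] := filter_ex (filterI (zP _ r0) (U8 m)).
have [An nPn] := xP n; apply: nPn; apply: mono (ltW h2) _; exact: rP.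
Qed.

Lemma fin_uniform (T : finType) (P : T -> R -> Prop) :
  (forall t c c', c' <= c -> P t c -> P t c') ->
  (forall t, exists2 c, 0 < c & P t c) ->
  exists2 c, 0 < c & forall t, P t c.
Proof.
move=> mono Pt; suff [c c0 cP] : exists2 c, 0 < c & forall t, t \in enum T -> P t c.
  by exists c => // t; apply: cP; rewrite mem_enum.
elim: (enum T) => [|t s [c c0 cP]]; first by exists 1.
have [d d0 dP] := Pt t; exists (Num.min c d); first by rewrite lt_min c0.
move=> t'; rewrite inE => /predU1P[->|/cP].
  by apply: mono dP; rewrite ge_min lexx orbT.
by apply: mono; rewrite ge_min lexx.
Qed.

Lemma uniform_cvg_cabsP (A : set C) (u : nat -> C -> C) (t : C -> C) :
  {uniform A, u @ \oo --> t} <-> forall e : R, 0 < e ->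
    exists m, forall n, (m <= n)%N -> forall z, A z -> cabs (u n z - t z) < e.
Proof.
split=> [ut e e0|ut P /uniform_nbhs[E [entE EP]]].
  have : nbhs (t : {uniform` A -> C})
      [set h : {uniform` A -> C} | forall y, A y -> cabs (h y - t y) < e].
    apply/uniform_nbhs; exists [set xy : C * C | ball xy.1 e%:C xy.2]; split.
      rewrite -entourage_from_ballE; exists e%:C => //=.
      by rewrite ltcR.
    by move=> h /= hP y /hP; rewrite /ball /= cabs_normE ltcR cabsC.
  by move=> /ut[m _ mP]; exists m => n /mP.
move: entE; rewrite -entourage_from_ballE => -[e /= e0 eE].
have eE' : e = (re e)%:C by rewrite RRe_real// gtr0_real.
have [|m mP] := ut (re e); first by rewrite -ltcR -eE'.
exists m => // n /mP h; apply: EP => y /h h'; apply: eE => /=.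
by rewrite /ball /= eE' cabs_normE ltcR cabsC.
Qed.

End CompactUniformity.

(** * The nonlinearity f'' / f' *)

Section DerivativeBounds.
Variable R : realType.
Local Notation C := (cplx R).
Implicit Types (f g : C -> C) (x z w : C) (r M : R).

(** The constant is chosen before f and the centre x: later both vary along a sequence. *)
Lemma Cauchy_derives d r : 0 < r -> exists2 c : R, 0 <= c &
  forall f x M, holo (cball x r) f ->
    (forall w, cball x r w -> cabs (f w) <= M) -> cabs (derives d f x) <= c * M.
Proof.
elim: d r => [|d IH] r r0.
  by exists 1 => // f x M _ fM; rewrite mul1r; apply: fM; exact: cball_center.
have r2 : 0 < r / 2 by lra.
have [c c0 cP] := IH _ r2; exists (c * (8 / r)) => [|f x M hf fM].
  by rewrite mulr_ge0// divr_ge0// ltW.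
rewrite derivesSr -mulrA; apply: cP.
  move=> w wx; apply: (holo_derive (@open_cball _ x r) hf).
  by move: wx; rewrite /cball /=; lra.
move=> w wx; have sub : cball w (r / 2) `<=` cball x r.
  by apply: cball_sub; move: wx; rewrite /cball /=; lra.
rewrite (_ : 8 / r * M = 4 * M / (r / 2)); last by field; exact: lt0r_neq0.
by apply: Cauchy_derive => //; [exact: holo_sub hf|move=> v /sub/fM].
Qed.

Lemma derivesB d f g (O : set C) : open O -> holo O f -> holo O g ->
  forall z, O z ->
  derives d (fun w => f w - g w) z = derives d f z - derives d g z.
Proof.
move=> oO hf hg; elim: d => // d IH z Oz; rewrite !derivesS.
have d1 := derivable_has_cderiv (@holo_derives _ d _ _ oO hf _ Oz).
have d2 := derivable_has_cderiv (@holo_derives _ d _ _ oO hg _ Oz).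
have [r r0 rO] := open_cball_sub oO Oz; apply: has_cderiv_derive.
by apply: (has_cderiv_near r0) (has_cderivB d1 d2) => w /rO/IH.
Qed.

End DerivativeBounds.

Section Nonlinearity.
Variable R : realType.
Local Notation C := (cplx R).
Implicit Types (f g : C -> C) (z : C).

Lemma derive_comp f g z : derivable f z 1 -> derivable g (f z) 1 ->
  derivable (g \o f) z 1 /\ 'D_1 (g \o f) z = 'D_1 g (f z) * 'D_1 f z.
Proof.
move=> /derivable_has_cderiv fd /derivable_has_cderiv gd.
by apply/has_cderivP; exact: has_cderiv_comp.
Qed.

(** The pre-Schwarzian derivative (log f')'; [T_fin] is its value at [f_word]. *)
Definition nonlinearity f z : C := 'D_1 ('D_1 f) z / 'D_1 f z.

Lemma nonlinearity_id z : nonlinearity id z = 0.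
Proof.
rewrite /nonlinearity; suff -> : 'D_1 ('D_1 (id : C -> C)) z = 0 by rewrite mul0r.
apply: has_cderiv_derive.
apply: (has_cderiv_near (@ltr01 R)) (has_cderiv_cst z (1 : C)) => w _.
by rewrite (has_cderiv_derive (has_cderiv_id w)).
Qed.

(** The logarithmic derivative of the chain rule: a cocycle identity, from which the recursion for T
    along words follows. *)
Lemma nonlinearity_comp f g (O O' : set C) z : open O -> open O' ->
  holo O f -> holo O' g -> (forall w, O w -> O' (f w)) -> O z ->
  'D_1 f z != 0 -> 'D_1 g (f z) != 0 ->
  nonlinearity (g \o f) z = nonlinearity g (f z) * 'D_1 f z + nonlinearity f z.
Proof.
move=> oO oO' hf hg fO Oz f0 g0.
have [_ dE] := derive_comp (hf _ Oz) (hg _ (fO _ Oz)).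
have d1 := derivable_has_cderiv (hf _ Oz).
have d2 := derivable_has_cderiv (holo_derive oO' hg (fO _ Oz)).
have d3 := derivable_has_cderiv (holo_derive oO hf Oz).
have [r r0 rO] := open_cball_sub oO Oz.
have ddE : 'D_1 ('D_1 (g \o f)) z = 'D_1 g (f z) * 'D_1 ('D_1 f) z +
    'D_1 f z * ('D_1 ('D_1 g) (f z) * 'D_1 f z).
  apply: has_cderiv_derive.
  apply: (has_cderiv_near r0) (has_cderivM (has_cderiv_comp d1 d2) d3) => v /rO Ov.
  exact/esym/(derive_comp (hf _ Ov) (hg _ (fO _ Ov))).2.
apply: etrans (congr2 (fun x y : C => x / y) ddE dE) _; rewrite /nonlinearity.
have alg (a b c d : C) : a != 0 -> b != 0 ->
    (b * c + a * (d * a)) / (b * a) = d / b * a + c / a.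
  by move=> a0 b0; field; rewrite a0 b0.
exact: alg f0 g0.
Qed.

Lemma holo_nonlinearity f (O : set C) : open O -> holo O f ->
  (forall z, O z -> 'D_1 f z != 0) -> holo O (nonlinearity f).
Proof.
move=> oO hf f0 z Oz; have d1 := derivable_has_cderiv (holo_derive oO hf Oz).
have d2 := derivable_has_cderiv (holo_derive oO (holo_derive oO hf) Oz).
apply: has_cderiv_derivable.
exact: has_cderivM d2 (@has_cderivV _ ('D_1 f) z _ (f0 _ Oz) d1).
Qed.

(** With E = f - (a g + b), the difference of the nonlinearities is (E'' - E' g''/g') / f', where a
    and b no longer appear. The 64 comes from two Cauchy estimates on discs of radius r / 2. *)
Lemma nonlinearity_perturb f g (a b : C) z (r e k T : R) : 0 < r -> 0 < k ->
  holo (cball z r) f -> holo (cball z r) g ->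
  (forall w, cball z r w -> cabs (f w - (a * g w + b)) <= e) ->
  k <= cabs ('D_1 f z) -> 'D_1 g z != 0 -> cabs (nonlinearity g z) <= T ->
  cabs (nonlinearity f z - nonlinearity g z) <= (64 / r ^+ 2 + 4 * T / r) * e / k.
Proof.
move=> r0 k0 hf hg fg kf g0 gT; have zz := cball_center z r0.
have rn0 := lt0r_neq0 r0; have r2 : 0 < r / 2 by lra.
have e0 : 0 <= e by apply: le_trans (fg _ zz); exact: cabs_ge0.
pose E1 w := 'D_1 f w - (a * 'D_1 g w + 0).
have dE w : cball z r w -> has_cderiv (fun w => f w - (a * g w + b)) w (E1 w).
  move=> wz; have d1 := derivable_has_cderiv (hf _ wz).
  have d2 := derivable_has_cderiv (hg _ wz).
  by apply: has_cderivB d1 (has_cderivD (has_cderivZ _ d2) (has_cderiv_cst _ _)).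
have E1b w s : 0 < s -> cball w s `<=` cball z r -> cabs (E1 w) <= 4 * e / s.
  move=> s0 sub; have ww := sub _ (cball_center w s0).
  apply: (Cauchy_estimate s0 _ _ (dE _ ww)) => v /sub vz; last exact: fg.
  by exists (E1 v); exact: dE.
have dE1 w : cball z r w -> has_cderiv E1 w
    ('D_1 ('D_1 f) w - (a * 'D_1 ('D_1 g) w + 0)).
  move=> wz; have oz := @open_cball _ z r.
  have d1 := derivable_has_cderiv (holo_derive oz hf wz).
  have d2 := derivable_has_cderiv (holo_derive oz hg wz).
  by apply: has_cderivB d1 (has_cderivD (has_cderivZ _ d2) (has_cderiv_cst _ _)).
have h1 : cabs (E1 z) <= 4 * e / r by apply: E1b.
have h2 : cabs ('D_1 ('D_1 f) z - (a * 'D_1 ('D_1 g) z + 0)) <= 64 * e / r ^+ 2.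
  rewrite (_ : 64 * e / r ^+ 2 = 4 * (4 * e / (r / 2)) / (r / 2)) => [|]; last first.
    by field.
  apply: (Cauchy_estimate r2 _ _ (dE1 _ zz)) => w wz.
    exists ('D_1 ('D_1 f) w - (a * 'D_1 ('D_1 g) w + 0)); apply: dE1.
    by move: wz; rewrite /cball /=; lra.
  by apply: E1b => //; apply: cball_sub; move: wz; rewrite /cball /=; lra.
have f0 : 'D_1 f z != 0 by rewrite -cabs_gt0; exact: lt_le_trans kf.
have alg (p q P Q : C) : p != 0 -> q != 0 ->
    P / p - Q / q = ((P - (a * Q + 0)) - (p - (a * q + 0)) * (Q / q)) / p.
  by move=> p0 q0; field; rewrite p0 q0.
rewrite [X in cabs X](alg _ _ _ _ f0 g0) cabsM cabsV.
apply: ler_pM; rewrite ?cabs_ge0 ?invr_ge0 ?cabs_ge0//; last first.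
  by rewrite lef_pV2 ?posrE ?cabs_gt0.
apply: le_trans (cabsB _ _) _; rewrite cabsM mulrDl; apply: lerD.
  by rewrite mulrAC.
have -> : 4 * T / r * e = 4 * e / r * T by field.
by apply: ler_pM; rewrite ?cabs_ge0.
Qed.

End Nonlinearity.

(** * Words and separation *)

Section Dynamics.
Variable R : realType.
Local Notation C := (cplx R).
Variables (N : nat) (Omega V : set C) (phi : 'I_N -> C -> C).
Hypothesis openO : open Omega.
Hypothesis openV : open V.
Hypothesis subV : closure Omega `<=` V.
Hypothesis holoV : forall k, holo V (phi k).
Hypothesis nzV : forall k z, V z -> 'D_1 (phi k) z != 0.
Hypothesis mapV : forall k z, V z -> Omega (phi k z).
Implicit Types (w u v s t : seq 'I_N) (k : 'I_N) (z : C).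

Let subO : Omega `<=` closure Omega. Proof. exact: subset_closure. Qed.
Let subOV : Omega `<=` V. Proof. by move=> z /subO/subV. Qed.

Lemma f_word_cons k w z : f_word phi (k :: w) z = f_word phi w (phi k z).
Proof. by []. Qed.

Lemma f_word_cat u v z : f_word phi (u ++ v) z = f_word phi v (f_word phi u z).
Proof. by elim: u z => //= k u IH z; exact: IH. Qed.

Lemma phi_word_rev w z : phi_word phi w z = f_word phi (rev w) z.
Proof.
elim: w z => // k w IH z; rewrite rev_cons -cats1 f_word_cat -IH.
by [].
Qed.

Lemma f_word_closure w z : closure Omega z -> closure Omega (f_word phi w z).
Proof.
elim: w z => [|k w IH] z cz; first exact: cz.
by rewrite f_word_cons; apply: IH; apply: subO; apply: mapV; exact: subV.
Qed.

Lemma f_word_derivable w : holo V (f_word phi w).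
Proof.
elim: w => [|k w IH] z Vz; first exact: derivable_id.
have /derivable_has_cderiv d1 := @holoV k z Vz.
have /derivable_has_cderiv d2 := IH _ (subOV (@mapV k z Vz)).
exact: has_cderiv_derivable (has_cderiv_comp d1 d2).
Qed.

Lemma derive_f_word_cons k w z : V z -> 'D_1 (f_word phi (k :: w)) z =
  'D_1 (f_word phi w) (phi k z) * 'D_1 (phi k) z.
Proof.
move=> Vz; have /derivable_has_cderiv d1 := @holoV k z Vz.
have /derivable_has_cderiv d2 := @f_word_derivable w _ (subOV (@mapV k z Vz)).
exact: has_cderiv_derive (has_cderiv_comp d1 d2).
Qed.

Lemma derive_f_word_nil z : 'D_1 (f_word phi [::]) z = 1.
Proof. exact: has_cderiv_derive (has_cderiv_id z). Qed.

Lemma derive_f_word_neq0 w z : V z -> 'D_1 (f_word phi w) z != 0.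
Proof.
elim: w z => [|k w IH] z Vz; first by rewrite derive_f_word_nil oner_eq0.
rewrite derive_f_word_cons//; apply: mulf_neq0; last exact: nzV.
by apply: IH; exact/subOV/mapV.
Qed.

Lemma T_fin_nil z : T_fin phi [::] z = 0.
Proof. exact: nonlinearity_id. Qed.

Lemma T_fin_cons k w z : V z -> T_fin phi (k :: w) z =
  T_fin phi w (phi k z) * 'D_1 (phi k) z + T_fin phi [:: k] z.
Proof.
move=> Vz; apply: (nonlinearity_comp openV openV (@holoV k)
  (@f_word_derivable w) _ Vz (@nzV k z Vz)).
  by move=> v /(@mapV k)/subOV.
by apply: derive_f_word_neq0; exact/subOV/mapV.
Qed.

Lemma holo_T_fin w : holo V (T_fin phi w).
Proof.
apply: (holo_nonlinearity openV (@f_word_derivable w)).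
exact: derive_f_word_neq0.
Qed.

Variables (rho kappa tau : R).
Hypothesis rho01 : 0 <= rho < 1.
Hypothesis rhoP : forall k z, closure Omega z -> cabs ('D_1 (phi k) z) <= rho.
Hypothesis kappa0 : 0 < kappa.
Hypothesis kappaP : forall k z, closure Omega z ->
  kappa <= cabs ('D_1 (phi k) z).
Hypothesis tau0 : 0 <= tau.
Hypothesis tauP : forall k z, closure Omega z ->
  cabs (T_fin phi [:: k] z) <= tau.

(** The fixed point of x |-> x rho + tau, so that the cocycle recursion preserves this bound. *)
Definition T_bound := tau / (1 - rho).

Lemma T_bound_ge0 : 0 <= T_bound.
Proof. by case/andP: rho01 => _ r1; rewrite divr_ge0// subr_ge0 ltW. Qed.

Let closure_phi k z : closure Omega z -> closure Omega (phi k z).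
Proof. by move=> cz; apply/subO/mapV/subV. Qed.

Lemma derive_f_word_lower w z : closure Omega z ->
  kappa ^+ size w <= cabs ('D_1 (f_word phi w) z).
Proof.
elim: w z => [|k w IH] z cz; first by rewrite derive_f_word_nil cabs1.
rewrite derive_f_word_cons; last exact: subV.
rewrite cabsM exprSr ler_pM ?exprn_ge0 ?(ltW kappa0)//; last exact: kappaP.
by apply: IH; exact: closure_phi.
Qed.

Lemma T_fin_bound w z : closure Omega z -> cabs (T_fin phi w z) <= T_bound.
Proof.
case/andP: rho01 => r0 r1.
elim: w z => [|k w IH] z cz; first by rewrite T_fin_nil cabs0 T_bound_ge0.
rewrite T_fin_cons; last exact: subV.
apply: le_trans (cabsD _ _) _; rewrite cabsM.
have h1 := IH _ (@closure_phi k z cz); have h2 := @rhoP k z cz.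
have h3 := @tauP k z cz; have h4 := cabs_ge0 ('D_1 (phi k) z).
apply: le_trans (lerD (ler_pM (cabs_ge0 _) h4 h1 h2) h3) _.
rewrite /T_bound; have n0 : 1 - rho != 0 by rewrite subr_eq0 gt_eqF.
by rewrite le_eqVlt; apply/orP; left; apply/eqP; field.
Qed.

(** Both terms contain the nonlinearity of the common prefix, which cancels. *)
Lemma T_fin_cat_sub w u v z : V z ->
  T_fin phi (w ++ u) z - T_fin phi (w ++ v) z =
  (T_fin phi u (f_word phi w z) - T_fin phi v (f_word phi w z)) *
  'D_1 (f_word phi w) z.
Proof.
elim: w z => [|k w IH] z Vz; first by rewrite derive_f_word_nil mulr1.
rewrite !cat_cons (@T_fin_cons k (w ++ u))// (@T_fin_cons k (w ++ v))//.
have Vk : V (phi k z) by exact/subOV/mapV.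
rewrite derive_f_word_cons// mulrA f_word_cons -IH//.
move: (T_fin phi (w ++ u) (phi k z)) (T_fin phi (w ++ v) (phi k z)).
move: ('D_1 (phi k) z) (T_fin phi [:: k] z).
by move=> a b c d; ring.
Qed.

Lemma derive_f_word_upper w z : closure Omega z ->
  cabs ('D_1 (f_word phi w) z) <= rho ^+ size w.
Proof.
elim: w z => [|k w IH] z cz; first by rewrite derive_f_word_nil cabs1.
rewrite derive_f_word_cons; last exact: subV.
rewrite cabsM exprSr ler_pM ?cabs_ge0//; last exact: rhoP.
by apply: IH; exact: closure_phi.
Qed.

Lemma T_fin_prefix w u v z : closure Omega z ->
  cabs (T_fin phi (w ++ u) z - T_fin phi (w ++ v) z) <=
  rho ^+ size w * (2 * T_bound).
Proof.
move=> cz; rewrite T_fin_cat_sub; last exact: subV.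
have cw := @f_word_closure w z cz; rewrite cabsM mulrC.
apply: ler_pM; rewrite ?cabs_ge0//; first exact: derive_f_word_upper.
apply: le_trans (cabsB _ _) _; rewrite mulr_natl mulr2n.
by apply: lerD; exact: T_fin_bound.
Qed.

(** [T_inf] is chosen by [get], so a uniform limit must be shown to exist; two prefixes of u with n
    common letters have T within a multiple of rho^n. *)
Lemma T_inf_cvg (u : nat -> 'I_N) :
  {uniform closure Omega, (fun n => T_fin phi (mkseq u n)) @ \oo -->
     T_inf Omega phi u}.
Proof.
have mk n m : (n <= m)%N -> exists v, mkseq u m = mkseq u n ++ v.
  move=> nm; exists (drop n (mkseq u m)).
  by rewrite -{1}(cat_take_drop n (mkseq u m)) /mkseq -map_take take_iota (minn_idPl nm).
have lim z : exists l, closure Omega z -> forall n,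
    cabs (T_fin phi (mkseq u n) z - l) <= 2 * (rho ^+ n * (2 * T_bound)).
  have [cz|ncz] := pselect (closure Omega z); last by exists 0.
  have [|l lP] := @complex_tail_limit R (fun n => T_fin phi (mkseq u n) z)
    (fun n => rho ^+ n * (2 * T_bound)).
    move=> n m /mk[v ->]; rewrite -{1}(cats0 (mkseq u n)).
    by have := T_fin_prefix (mkseq u n) [::] v cz; rewrite size_mkseq.
  by exists l.
have [t tP] := choice lim.
rewrite /T_inf; apply: (@getPex _ (fun t : C -> C =>
    {uniform closure Omega, (fun n => T_fin phi (mkseq u n)) @ \oo --> t})).
exists t; apply/uniform_cvg_cabsP => e e0.
have [m mP] := expr_small_mul (2 * (2 * T_bound)) rho01 e0.
exists m => n mn z cz; apply: le_lt_trans (tP z cz n) _; apply: le_lt_trans mP.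
have : rho ^+ n <= rho ^+ m by apply: ler_wiXn2l => //; case/andP: rho01 => ? /ltW.
by move=> /(ler_wpM2r T_bound_ge0); lra.
Qed.

(** Having the same [take m] for all m encodes convergence to W. A finite word shorter than m is its
    own prefix, so the limit remembers a finite length. *)
Definition word_take m (W : word N) : seq 'I_N :=
  match W with FinWord s => take m s | InfWord u => mkseq u m end.

Lemma word_take_take m W : take m (word_take m W) = word_take m W.
Proof.
case: W => [s|u] /=; first by rewrite take_takel.
by rewrite take_oversize// size_mkseq.
Qed.

Lemma T_word_close m s W z : take m s = word_take m W -> closure Omega z ->
  cabs (T_fin phi s z - T_word Omega phi W z) <= rho ^+ m * (2 * T_bound).
Proof.
case/andP: rho01 => r0 r1 sW cz.
have b0 : 0 <= rho ^+ m * (2 * T_bound).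
  by rewrite mulr_ge0 ?exprn_ge0// mulr_ge0// T_bound_ge0.
case: W sW => [t|u] /= st.
  have [ms|sm] := leqP m (size s).
    have := T_fin_prefix (take m s) (drop m s) (drop m t) cz.
    have e1 : take m s ++ drop m s = s := cat_take_drop m s.
    have e2 : take m s ++ drop m t = t by rewrite st cat_take_drop.
    by rewrite (size_takel ms) e1 e2.
  (* A word shorter than m with the same m-prefix as t is t itself. *)
  have es : s = take m t by rewrite -st take_oversize// ltnW.
  suff -> : t = s by rewrite subrr cabs0.
  have [tm|mt] := leqP (size t) m; first by rewrite es take_oversize.
  by move: sm; rewrite es (size_takel (ltnW mt)) ltnn.
have se : s = mkseq u m ++ drop m s by rewrite -st cat_take_drop.
apply/ler_addgt0Pr => e e0.
have [p pP] := (uniform_cvg_cabsP _ _ _).1 (T_inf_cvg (u := u)) _ e0.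
pose n := maxn m p; have mn : (m <= n)%N by exact: leq_maxl.
have := pP n (leq_maxr _ _) z cz => /ltW h.
have nE : mkseq u n = mkseq u m ++ drop m (mkseq u n).
  by rewrite -{1}(cat_take_drop m (mkseq u n)) /mkseq -map_take take_iota (minn_idPl mn).
apply: le_trans (cabs_dist (T_fin phi (mkseq u n) z) _ _) _; apply: lerD => //.
rewrite se nE; have := T_fin_prefix (mkseq u m) (drop m s) (drop m (mkseq u n)) cz.
by rewrite size_mkseq.
Qed.

Lemma T_word_approx W (e : R) : 0 < e -> exists s, forall z, closure Omega z ->
  cabs (T_fin phi s z - T_word Omega phi W z) <= e.
Proof.
move=> e0; have [m mP] := expr_small_mul (2 * T_bound) rho01 e0.
exists (word_take m W) => z cz.
apply: le_trans (T_word_close (word_take_take m W) cz) _.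
by rewrite mulrC; exact: ltW.
Qed.

Lemma holo_T_word W : holo Omega (T_word Omega phi W).
Proof.
move=> z Oz; have [r r0 rO] := open_cball_sub openO Oz.
apply: (holo_limit r0) => e e0; have [s sP] := T_word_approx W e0.
exists (T_fin phi s); split; last by move=> w /rO/subO; exact: sP.
by apply: holo_sub (@holo_T_fin s) => w /rO/subOV.
Qed.

(** The identity theorem works in Omega while the separation hypothesis concerns its closure. The
    approximants [T_fin] are continuous on V and carry the equality to the boundary. *)
Lemma T_word_eq_closure W W' :
  (forall z, Omega z -> T_word Omega phi W z = T_word Omega phi W' z) ->
  forall z, closure Omega z -> T_word Omega phi W z = T_word Omega phi W' z.
Proof.
move=> eqO z cz; apply/eqP; rewrite -subr_eq0 -cabs_eq0 eq_le cabs_ge0 andbT.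
apply/ler_addgt0Pr => e e0; rewrite add0r; have e6 : 0 < e / 6 by lra.
have [s sP] := T_word_approx W e6; have [t tP] := T_word_approx W' e6.
have [r r0 rP] := derivable_ccont (@holo_T_fin s _ (subV cz)) e6.
have [r' r'0 rP'] := derivable_ccont (@holo_T_fin t _ (subV cz)) e6.
have rr : 0 < Num.min r r' by rewrite lt_min r0.
have [w Ow] := (closure_cabsP _ _).1 cz _ rr.
rewrite lt_min => /andP[/rP h1 /rP' h2].
have h3 := sP z cz; have h4 := tP z cz.
have h5 := sP w (subO Ow); have h6 := tP w (subO Ow).
rewrite -(eqO _ Ow) in h6; move: h1 h2 h3 h4 h5 h6.
move: (T_word _ _ W z) (T_word _ _ W' z) (T_word _ _ W w) (T_fin _ s z).
move: (T_fin _ s w) (T_fin _ t z) (T_fin _ t w) => s1 t0 t1 a b c s0.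
move=> h1 h2 h3 h4 h5 h6.
have := cabs_dist s0 a b; have := cabs_dist s1 s0 b; have := cabs_dist c s1 b.
have := cabs_dist t1 c b; have := cabs_dist t0 t1 b.
by rewrite (cabsC a s0) (cabsC s0 s1) (cabsC c t1); lra.
Qed.

(** [onth] takes values in a finite type, with None beyond the end, so each position is constant
    along U. If some position is None, words agreeing up to it are equal and any of them is the
    limit; otherwise the letters form an infinite word. *)
Lemma word_limit (U : set_system nat) (s : nat -> seq 'I_N) : UltraFilter U ->
  exists W, forall m, U [set n | take m (s n) = word_take m W].
Proof.
move=> uU; have pU := @ultra_proper _ _ uU.
have [om omP] := choice (fun k : nat => ultra_const uU (fun n => onth (s n) k)).
have prefix m : U [set n | forall k : nat, (k < m)%N -> onth (s n) k = om k].
  elim: m => [|m IH]; first by apply: (@filterE _ U).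
  apply: filterS (filterI IH (omP m)) => n [/= h1 h2] k.
  by rewrite ltnS leq_eqVlt => /predU1P[->|/h1].
have [[k0 ok0]|nN] := pselect (exists k : nat, om k = None).
  have [n0 /= n0P] := filter_ex (prefix k0.+1); exists (FinWord (s n0)) => m /=.
  apply: filterS (prefix k0.+1) => n /= nP; congr take; apply: eq_from_onth => k.
  have [kk|kk] := ltnP k k0.+1; first by rewrite nP// n0P.
  have le l : onth (s l) k0 = om k0 -> (size (s l) <= k)%N.
    by move=> e; rewrite (leq_trans _ (ltnW kk))// -onthNE e ok0.
  by rewrite !onth_default// le ?nP ?n0P.
have [u uP] : exists u : nat -> 'I_N, forall k : nat, om k = Some (u k).
  have : forall k : nat, exists a : 'I_N, om k = Some a.
    by move=> k; case E : (om k) => [a|]; [exists a|case: nN; exists k].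
  by move=> /choice[u uP]; exists u.
exists (InfWord u) => m; apply: filterS (prefix m) => n /= nP.
have ms : (m <= size (s n))%N.
  case: m nP => // m nP; rewrite -onthTE nP// uP.
  by [].
apply: (@eq_from_nth _ (u 0%N)); first by rewrite size_takel// size_mkseq.
move=> k; rewrite size_takel// => km; rewrite nth_take// nth_mkseq//.
by apply: onth_nth; rewrite nP// uP.
Qed.

(** Agreement one letter beyond the end of a finite limit fixes the length of the approximating
    word, and rules out one finite and one infinite limit. A single m beyond both finite lengths
    therefore suffices. *)
Lemma word_limit_length (s t : seq 'I_N) W W' : size s = size t ->
  (forall m, (m <= 1 + size (if W is FinWord a then a else [::]) +
     size (if W' is FinWord b then b else [::]))%N ->
     take m s = word_take m W /\ take m t = word_take m W') ->
  word_length W = word_length W'.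
Proof.
have fin (x a : seq 'I_N) : take (size a).+1 x = take (size a).+1 a ->
    size x = size a.
  rewrite [RHS]take_oversize// => e; move: (congr1 size e); rewrite size_take.
  by case: ifP => // _ /eqP; rewrite -[_ == _]/(_ == _) eqn_leq ltnn.
have inf (x : seq 'I_N) (u : nat -> 'I_N) m : take m x = mkseq u m -> (m <= size x)%N.
  by move=> /(congr1 size); rewrite size_mkseq size_take; case: ltnP => [/ltnW//|] _ ->.
case: W W' => [a|u] [b|v] //= st lim.
- have [e1 _] := lim (size a).+1 (leq_addr _ _).
  have [|_ e2] := lim (size b).+1; first by rewrite addnAC leq_addr.
  by rewrite -(fin _ _ e1) -(fin _ _ e2) st.
- have [e1 e2] := lim (size a).+1 (leq_addr _ _).
  by have := inf _ _ _ e2; rewrite -st (fin _ _ e1) ltnn.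
- have [|e1 e2] := lim (size b).+1; first by rewrite addnAC leq_addr.
  by have := inf _ _ _ e1; rewrite st (fin _ _ e2) ltnn.
Qed.

(** * Uniform lower bound for some derivative of T_s - T_t *)

Hypothesis boundedO : bounded_set Omega.
Hypothesis connectedO : connected Omega.
Variable r0 : R.
Hypothesis r00 : 0 < r0.
Hypothesis r0P : forall k z, closure Omega z -> cball (phi k z) r0 `<=` Omega.
Hypothesis T_separated : forall W W' : word N, W <> W' ->
  word_length W = word_length W' ->
  exists2 z, closure Omega z & T_word Omega phi W z <> T_word Omega phi W' z.

Let Tdiff s t : C -> C := fun w : C => T_fin phi s w - T_fin phi t w.

Let holo_Tdiff s t : holo V (Tdiff s t).
Proof.
by move=> z Vz; have [] := deriveB_cplx (@holo_T_fin s z Vz) (@holo_T_fin t z Vz).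
Qed.

(* Compactness: along an ultrafilter, a sequence of pairs of words converges to
   a pair of distinct words of equal, possibly infinite, length; if all
   derivatives tended to 0 the identity theorem would equate the limits. *)
Lemma uniform_order : exists D, exists2 delta : R, 0 < delta &
  forall s t k z, size s = size t -> take 1 s <> take 1 t -> closure Omega z ->
  exists2 d, (d <= D)%N & delta <= cabs (derives d (Tdiff s t) (phi k z)).
Proof.
apply: contrapT => nP.
(* The failure is read with D = n and delta = 1 / (n + 1) at once. *)
have bad n : exists q : (seq 'I_N * seq 'I_N) * ('I_N * C),
    [/\ size q.1.1 = size q.1.2, take 1 q.1.1 <> take 1 q.1.2,
        closure Omega q.2.2 & forall d, (d <= n)%N ->
        cabs (derives d (Tdiff q.1.1 q.1.2) (phi q.2.1 q.2.2)) < n.+1%:R^-1].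
  apply: contrapT => nq; apply: nP; exists n, n.+1%:R^-1; first by rewrite invr_gt0.
  move=> s t k z st st1 cz; apply: contrapT => nd; apply: nq.
  exists ((s, t), (k, z)); split => // d dn; rewrite ltNge.
  by apply/negP => h; apply: nd; exists d.
have [q qP] := choice bad; have [U [uU U8]] := nat_ultrafilter.
have pU := @ultra_proper _ _ uU.
have [W WP] := @word_limit U (fun n => (q n).1.1) uU.
have [W' WP'] := @word_limit U (fun n => (q n).1.2) uU.
have [k kP] := ultra_const uU (fun n => (q n).2.1).
have [M MO] := bounded_closure boundedO.
have [n|z zP] := @ultra_complex_limit R U uU M (fun n => (q n).2.2).
  by apply: MO; have [] := qP n.
have cz : closure Omega z.
  apply: closed_closure; apply/closure_cabsP => e e0.
  by have [n /= xn] := filter_ex (zP _ e0); exists (q n).2.2 => //; have [] := qP n.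
have lenW : word_length W = word_length W'.
  pose m0 := (1 + size (if W is FinWord a then a else [::]) +
     size (if W' is FinWord b then b else [::]))%N.
  have : U [set n | forall m : 'I_m0.+1,
      take m (q n).1.1 = word_take m W /\ take m (q n).1.2 = word_take m W'].
    apply: (@filter_forall nat 'I_m0.+1 (fun m n =>
      take m (q n).1.1 = word_take m W /\ take m (q n).1.2 = word_take m W')).
    by move=> m; apply: filterS (filterI (WP m) (WP' m)) => n [].
  move=> /filter_ex[n /= nP']; have [qs _ _ _] := qP n.
  apply: (word_limit_length qs) => m mm; rewrite -ltnS in mm.
  exact: (nP' (Ordinal mm)).
(* Prefixes of length 1 already distinguish the limits, since the first letters differ along the
   whole sequence. *)
have WW' : W <> W'.
  move=> e; have [n [/= h1 h2]] := filter_ex (filterI (WP 1%N) (WP' 1%N)).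
  by have [_ + _ _] := qP n; apply; rewrite h1 h2 e.
have [y cy] := T_separated WW' lenW; apply.
apply: T_word_eq_closure cy => x Ox; apply/eqP; rewrite -subr_eq0; apply/eqP.
pose g (w : C) := T_word Omega phi W w - T_word Omega phi W' w.
have hg : holo Omega g.
  move=> w Ow; have [] := deriveB_cplx (@holo_T_word W _ Ow) (@holo_T_word W' _ Ow).
  by [].
have Oz : Omega (phi k z) by exact/mapV/subV.
apply: (identity_theorem openO connectedO hg Oz _ Ox) => d.
apply/eqP; rewrite -cabs_eq0 eq_le cabs_ge0 andbT.
(* One third each for moving phi_k(z) to phi_k(z_n), for replacing the limits by T_s and T_t, and
   for the derivative of T_s - T_t itself. *)
apply/ler_addgt0Pr => e e0; rewrite add0r; have e3 : 0 < e / 3 by lra.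
(* Discs of radius r0 about every phi_k(z_n) lie in Omega, so one constant serves all n. *)
have [c c0 cP] := @Cauchy_derives R d r0 r00.
have [d1 d10 d1P] := derivable_ccont (@holo_derives _ d _ _ openO hg _ Oz) e3.
have [d2 d20 d2P] := derivable_ccont (@holoV k z (subV cz)) d10.
have [m mP] := expr_small_mul (c * (2 * (2 * T_bound))) rho01 e3.
have [l lP] := harmonic_small e3.
have [n [[/= n1 n2] [/= n3 [n4 n5]]]] := filter_ex (filterI
  (filterI (WP m) (WP' m)) (filterI kP (filterI (zP _ d20) (U8 (maxn d l))))).
have [_ _ cn dn] := qP n.
have dln : (d <= n)%N by apply: leq_trans n5; exact: leq_maxl.
have lln : (l <= n)%N by apply: leq_trans n5; exact: leq_maxr.
move: (dn d dln) (lP n lln) cn n1 n2 n4; rewrite n3.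
case: (q n) => [[s t] [k' zn]] /= h1 h2 cn n1 n2 n4.
have Ozn : Omega (phi k zn) by exact/mapV/subV.
have h3 := d1P _ (d2P _ n4).
have h4 : cabs (derives d (fun w : C => g w - Tdiff s t w) (phi k zn)) <=
    c * (2 * (rho ^+ m * (2 * T_bound))).
  have hT : holo Omega (Tdiff s t) by apply: holo_sub (@holo_Tdiff s t); exact: subOV.
  apply: cP => w /(r0P cn) Ow.
    by have [] := deriveB_cplx (hg _ Ow) (hT _ Ow).
  have := lerD (T_word_close n1 (subO Ow)) (T_word_close n2 (subO Ow)).
  rewrite /g /Tdiff.
  move: (T_word Omega phi W w) (T_word Omega phi W' w) => a b.
  move: (T_fin phi s w) (T_fin phi t w) => a' b' le.
  rewrite (_ : a - b - (a' - b') = (b' - b) - (a' - a)); last by ring.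
  apply: le_trans (cabsB _ _) _; lra.
have hT : holo Omega (Tdiff s t) by apply: holo_sub (@holo_Tdiff s t); exact: subOV.
rewrite (derivesB d openO hg hT Ozn) in h4.
move: h1 h3 h4 mP.
move: (derives d g (phi k z)) (derives d g (phi k zn)) => a b.
move: (derives d (Tdiff s t) (phi k zn)) => b' h1 h3 h4 mP.
have h5 : cabs (b - b') < e / 3.
  apply: le_lt_trans h4 _; apply: le_lt_trans mP.
  by rewrite le_eqVlt; apply/orP; left; apply/eqP; ring.
have h6 := lt_trans h1 h2.
have := cabsB b (b - a); rewrite (_ : b - (b - a) = a); last by ring.
have := cabsD (b - b') b'; rewrite subrK; lra.
Qed.

(** * Transport of the lower bound and separation *)

Hypothesis kappa1 : kappa <= 1.

Let f_word_O w z : Omega z -> Omega (f_word phi w z).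
Proof.
elim: w z => [|k w IH] z Oz; first exact: Oz.
by rewrite f_word_cons; apply: IH; apply: mapV; exact: subOV.
Qed.

(** Differentiating (g^(d) o f_u) gives (g^(d+1) o f_u) f_u', so each order costs one Cauchy
    estimate on a halved disc and one division by |f_u'| >= kappa^|u|; order 0 already costs one
    division. No formula for higher derivatives of a composition is needed, and c is independent of
    u. *)
Lemma descent z0 r d : 0 < r -> cball z0 r `<=` Omega ->
  exists2 c : R, 0 <= c & forall u (g : C -> C) eta, holo Omega g ->
  (forall w : C, cball z0 r w ->
     cabs (g (f_word phi u w) * 'D_1 (f_word phi u) w) <= eta) ->
  forall w : C, cball z0 (r / 2 ^+ d) w ->
  cabs (derives d g (f_word phi u w)) <= c * eta * (kappa ^- size u) ^+ d.+1.
Proof.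
move=> r_gt0 rO; elim: d => [|d [c c0 cP]].
  exists 1 => // u g eta hg gE w; rewrite expr0 divr1 => wz.
  have kw := derive_f_word_lower u (subO (rO _ wz)).
  have k0 : 0 < kappa ^+ size u by rewrite exprn_gt0.
  have := gE _ wz; rewrite cabsM mul1r expr1 ler_pdivlMr//; apply: le_trans.
  by rewrite ler_wpM2l ?cabs_ge0.
have p0 : 0 < r / 2 ^+ d.+1 by rewrite divr_gt0 ?exprn_gt0.
have half : r / 2 ^+ d = r / 2 ^+ d.+1 + r / 2 ^+ d.+1.
  by rewrite exprS; field; rewrite expf_neq0.
exists (4 * c / (r / 2 ^+ d.+1)) => [|u g eta hg gE w wz].
  by rewrite divr_ge0 ?mulr_ge0// ltW.
set x := kappa ^- size u; set rd := r / 2 ^+ d.+1 in p0 half wz *.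
have sub : cball w rd `<=` cball z0 (r / 2 ^+ d).
  by apply: cball_sub; move: wz; rewrite half /cball /=; lra.
have subr : cball z0 (r / 2 ^+ d) `<=` Omega.
  move=> v vz; apply: rO; apply: lt_le_trans vz _.
  by rewrite ler_pdivrMr ?exprn_gt0// ler_pMr// exprn_ege1// ler1n.
have ww := cball_center w p0; have Ow := subr _ (sub _ ww).
have hd (v : C) : Omega v -> has_cderiv (fun v : C => derives d g (f_word phi u v)) v
    (derives d.+1 g (f_word phi u v) * 'D_1 (f_word phi u) v).
  move=> Ov; have d1 := derivable_has_cderiv (@f_word_derivable u _ (subOV Ov)).
  have d2 := derivable_has_cderiv
    (@holo_derives _ d _ _ openO hg _ (@f_word_O u _ Ov)).
  exact: has_cderiv_comp d1 d2.
have hcp : holo (cball w rd) (fun v : C => derives d g (f_word phi u v)).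
  by move=> v /sub/subr/hd/has_cderiv_derivable.
have := Cauchy_derive p0 hcp (fun (v : C) vw => cP u g eta hg gE v (sub _ vw)).
rewrite (has_cderiv_derive (hd _ Ow)) cabsM => le.
have kw := derive_f_word_lower u (subO Ow).
have k0 : 0 < kappa ^+ size u by rewrite exprn_gt0.
have -> : 4 * c / rd * eta * x ^+ d.+2 = 4 * (c * eta * x ^+ d.+1) / rd * x.
  by rewrite [x ^+ d.+2]exprSr; field; exact: lt0r_neq0.
rewrite /x ler_pdivlMr//; apply: le_trans le.
by rewrite ler_wpM2l ?cabs_ge0.
Qed.

Lemma split_words (i j : seq 'I_N) : size i = size j -> i <> j ->
  exists u s t, [/\ i = u ++ s, j = u ++ t, size s = size t & take 1 s <> take 1 t].
Proof.
elim: i j => [|a i IH] [|b j] //= [ij] ne.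
have [ab|ab] := eqVneq a b.
  have [|u [s [t [-> -> st1 st2]]]] := IH _ ij; first by move=> e; apply: ne; rewrite ab e.
  by exists (a :: u), s, t; split => //; rewrite ab.
exists [::], (a :: i), (b :: j); split => //=; first by rewrite ij.
by rewrite !take0 => -[] /eqP; rewrite (negbTE ab).
Qed.

(** The bound of [uniform_order] holds at images of the closure: the last letter of u supplies one,
    and the outer map [phi k] does when u is empty. *)
Lemma f_word_image u k p : closure Omega p -> exists l y,
  closure Omega y /\ f_word phi u (phi k p) = phi l y.
Proof.
move=> cp; case/lastP: u => [|u l]; first by exists k, p.
exists l, (f_word phi u (phi k p)); split; last by rewrite -cats1 f_word_cat.
by apply: f_word_closure; exact: closure_phi.
Qed.

Lemma T_difference_lower k0 p r : Omega p -> 0 < r ->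
  cball (phi k0 p) r `<=` Omega ->
  exists2 c : R, 0 < c & exists E, forall (i j : seq 'I_N) eta,
    size i = size j -> i <> j ->
    (forall w : C, cball (phi k0 p) r w -> cabs (Tdiff i j w) <= eta) ->
    c * kappa ^+ (size i * E) <= eta.
Proof.
move=> Op r_gt0 rO; set z0 := phi k0 p in rO *.
have [D [delta delta0 deltaP]] := uniform_order.
have [c cP] : exists c : nat -> R, forall d, 0 <= c d /\
   forall u (g : C -> C) eta, holo Omega g ->
  (forall w : C, cball z0 r w ->
     cabs (g (f_word phi u w) * 'D_1 (f_word phi u) w) <= eta) ->
  cabs (derives d g (f_word phi u z0)) <= c d * eta * (kappa ^- size u) ^+ d.+1.
  have : forall d, exists c : R, 0 <= c /\
   forall u (g : C -> C) eta, holo Omega g ->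
  (forall w : C, cball z0 r w ->
     cabs (g (f_word phi u w) * 'D_1 (f_word phi u) w) <= eta) ->
  cabs (derives d g (f_word phi u z0)) <= c * eta * (kappa ^- size u) ^+ d.+1.
    move=> d; have [c c0 cP] := descent d r_gt0 rO; exists c; split => // u g eta hg gE.
    by apply: cP hg gE _ _; apply: cball_center; rewrite divr_gt0 ?exprn_gt0.
  by move=> /choice[c cP]; exists c.
(* The order d depends on the pair of words; the sum dominates every c d with d <= D, and the 1
   keeps it positive. *)
pose K := \sum_(d < D.+1) c d + 1.
have K0 : 0 < K by rewrite ltr_wpDl// sumr_ge0// => d _; case: (cP d).
have cK d : (d <= D)%N -> c d <= K.
  rewrite -ltnS => dD; rewrite /K (bigD1 (Ordinal dD))//= -addrA lerDl.
  by rewrite addr_ge0// sumr_ge0// => d' _; case: (cP d').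
exists (delta / K); first by rewrite divr_gt0.
exists D.+1 => i j eta ij ne TE.
have [u [s [t [iE jE st st1]]]] := split_words ij ne.
have eta0 : 0 <= eta by apply: le_trans (TE z0 (cball_center _ r_gt0)); exact: cabs_ge0.
have [l [y [cy yE]]] := @f_word_image u k0 p (subO Op).
have [d dD dP] := deltaP s t l y st st1 cy.
have [cd0 cdP] := cP d.
have hT : holo Omega (Tdiff s t) by apply: holo_sub (@holo_Tdiff s t); exact: subOV.
have := cdP u (Tdiff s t) eta hT; rewrite yE => /(_ _)/(le_trans dP) le.
have {}le : delta <= c d * eta * (kappa ^- size u) ^+ d.+1.
  apply: le => w wz; rewrite /Tdiff -T_fin_cat_sub -?iE -?jE; first exact: TE.
  by apply: subOV; exact: rO.
have k1 : 1 <= kappa^-1 by rewrite invf_ge1.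
have ki : 0 <= kappa^-1 by rewrite invr_ge0 ltW.
have le2 : (kappa ^- size u) ^+ d.+1 <= (kappa ^+ (size i * D.+1))^-1.
  rewrite -!exprVn -exprM; apply: ler_weXn2l => //.
  by apply: leq_mul; rewrite ?ltnS// iE size_cat leq_addr.
set x := kappa ^+ (size i * _) in le2 *.
have x0 : 0 < x by rewrite exprn_gt0.
rewrite -ler_pdivlMr//; rewrite ler_pdivrMr//; apply: le_trans le _.
rewrite [eta / x * K]mulrC mulrA; apply: ler_pM => //.
- by rewrite mulr_ge0.
- by rewrite exprn_ge0// invr_ge0 exprn_ge0// ltW.
- by rewrite ler_wpM2r// cK.
Qed.

(** [sup] dominates its elements only when the set is bounded above; the bound comes from that of
    Omega. *)
Lemma similarity_sup_ge (i j : seq 'I_N) (A : C -> C) z : similarity A ->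
  closure Omega z ->
  cabs (f_word phi i z - A (f_word phi j z)) <=
  sup [set cabs (f_word phi i x - A (f_word phi j x)) | x in closure Omega].
Proof.
move=> simA cz; apply: ub_le_sup; last by exists z.
have [M MO] := bounded_closure boundedO.
have [L AL] : exists L, forall w : C, closure Omega w -> cabs (A w) <= L.
  case: simA => a [b [_ [AE|AE]]]; exists (cabs a * M + cabs b) => w cw.
    rewrite AE; apply: le_trans (cabsD _ _) _; rewrite lerD2r cabsM.
    by rewrite ler_wpM2l ?cabs_ge0 ?MO.
  rewrite AE; apply: le_trans (cabsD _ _) _; rewrite lerD2r cabsM cabs_conj.
  by rewrite ler_wpM2l ?cabs_ge0 ?MO.
exists (M + L) => _ [x cx <-]; apply: le_trans (cabsB _ _) _.
apply: lerD; first by apply: MO; exact: f_word_closure.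
by apply: AL; exact: f_word_closure.
Qed.

Lemma exponential_separation k0 p : Omega p -> exists2 c : R, 0 < c &
  forall (i j : seq 'I_N) (A : C -> C), size i = size j -> i <> j ->
  similarity A -> c ^+ size i <=
  sup [set cabs (f_word phi i x - A (f_word phi j x)) | x in closure Omega].
Proof.
move=> Op; set z0 := phi k0 p; pose r := r0; have r2 : 0 < r / 2 by rewrite divr_gt0.
have rO : cball z0 r `<=` Omega by apply: r0P; exact: subO.
have sub2 : cball z0 (r / 2) `<=` cball z0 r by apply: cball_sub; rewrite subrr cabs0; lra.
have [|c1 c10 [E c1P]] := @T_difference_lower k0 p (r / 2) Op r2.
  by move=> w /sub2/rO.
pose K := 64 / (r / 2) ^+ 2 + 4 * T_bound / (r / 2).
have K0 : 0 < K.
  rewrite ltr_pwDl ?divr_gt0 ?exprn_gt0//.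
  by rewrite divr_ge0 ?(ltW r2)// mulr_ge0// T_bound_ge0.
(* c1 / K serves the orientation-preserving similarities, r / 36 the others, and 1 allows c2^n <= c2
   for n >= 1. *)
pose c2 := Num.min 1 (Num.min (c1 / K) (r / 36)).
have c20 : 0 < c2 by rewrite !lt_min ltr01 !divr_gt0.
have c21 : c2 <= 1 by rewrite /c2 ge_min lexx.
have c2K : c2 <= c1 / K by rewrite /c2 !ge_min lexx orbT.
have c2r : c2 <= r / 36 by rewrite /c2 !ge_min lexx !orbT.
(* The exponent E comes from the lower bound on T_i - T_j, one more from dividing by f_i' in
   [nonlinearity_perturb]. *)
exists (c2 * kappa ^+ E.+1) => [|i j A ij ne simA].
  by rewrite mulr_gt0// exprn_gt0.
set e := sup _; pose n := size i.
have eP z : closure Omega z -> cabs (f_word phi i z - A (f_word phi j z)) <= e.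
  by move=> cz; exact: similarity_sup_ge.
have kp m : 0 < kappa ^+ m by rewrite exprn_gt0.
have Oz0 : Omega z0 by apply: rO; exact: cball_center.
have e0 : 0 <= e by apply: le_trans (eP z0 (subO Oz0)); exact: cabs_ge0.
have n0 : (0 < n)%N.
  rewrite lt0n; apply/eqP => /size0nil i0; apply: ne; move: ij.
  by rewrite i0 => /esym/size0nil ->.
suff main : c2 * kappa ^+ (n * E.+1) <= e.
  apply: le_trans main; rewrite exprMn -exprM mulnC.
  rewrite ler_pM2r// -/n; case: (n) n0 => // m _; rewrite exprS.
  apply: ler_piMr; first exact: ltW.
  by apply: exprn_ile1; [exact: ltW|].
have hO w : holo Omega (f_word phi w).
  by apply: holo_sub (@f_word_derivable w); exact: subOV.
case: simA => a [b [_ [AE|AE]]].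
  have TE (w : C) : cball z0 (r / 2) w -> cabs (Tdiff i j w) <= K * e / kappa ^+ n.
    move=> wz; have sub : cball w (r / 2) `<=` Omega.
      move=> v vw; apply: rO; apply: cball_sub vw.
      by move: wz; rewrite /cball /=; lra.
    have Ow := sub _ (cball_center w r2).
    apply: (@nonlinearity_perturb R _ _ a b w (r / 2)) => //.
    - exact: holo_sub (hO i).
    - exact: holo_sub (hO j).
    - by move=> v /sub Ov; rewrite -AE; apply: eP; exact: subO.
    - by apply: derive_f_word_lower; exact: subO.
    - by apply: derive_f_word_neq0; exact: subOV.
    - by apply: T_fin_bound; exact: subO.
  have := c1P i j _ ij ne TE; rewrite ler_pdivlMr// -/n -mulrA -exprD -mulnSr => h.
  rewrite -(ler_pM2l K0); apply: le_trans h.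
  by rewrite mulrA ler_pM2r// mulrC -ler_pdivlMr.
have kn : kappa ^+ (n * E.+1) <= kappa ^+ n.
  by apply: ler_wiXn2l; [exact: ltW|by []|rewrite leq_pmulr].
have conjE (x y z : C) : conjc (conjc x * y + conjc z) = x * conjc y + z.
  case: x y z => [x1 x2] [y1 y2] [z1 z2]; apply/eqP; rewrite eq_complex /=.
  by apply/andP; split; apply/eqP; ring.
have : r / 36 * kappa ^+ n <= e.
  (* [Cauchy_conj] asks for a positive error, whereas e is only known to be nonnegative. *)
  apply/ler_addgt0Pr => e' e'0.
  have kf := @derive_f_word_lower i _ (subO Oz0).
  have r_gt0 : 0 < r by [].
  have ee : 0 < e + e' by lra.
  (* The conjugate of this function is A o f_j. *)
  have hg : holo (cball z0 r) (fun w : C => conjc a * f_word phi j w + conjc b).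
    move=> w /rO Ow; have d1 := derivable_has_cderiv (hO j _ Ow).
    exact: has_cderiv_derivable (has_cderivD (has_cderivZ _ d1) (has_cderiv_cst _ _)).
  have := Cauchy_conj r_gt0 ee (holo_sub rO (hO i)) hg; rewrite -/z0.
  move=> /(_ _)/(le_trans kf) h; have {}h : kappa ^+ n <= 36 * (e + e') / r.
    apply: h => w /rO Ow; rewrite conjE -AE.
    by have := eP w (subO Ow); lra.
  move: h; rewrite ler_pdivlMr// => h; lra.
apply: le_trans; apply: ler_pM => //; exact: ltW.
Qed.

End Dynamics.

(** * Domain and uniform constants of the system *)

Section Constants.
Variable R : realType.
Local Notation C := (cplx R).
Variables (N : nat) (Omega : set C) (phi : 'I_N -> C -> C).
Hypothesis cifs : conformal_ifs Omega phi.

(** Restricting Omega' to the points that every phi_k sends into Omega keeps an open neighbourhood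
    of the closure, on which all compositions f_w are defined and holomorphic. *)
Lemma conformal_ifs_domain : exists V : set C,
  [/\ open V, closure Omega `<=` V, forall k, holo V (phi k),
      forall k z, V z -> 'D_1 (phi k) z != 0 &
      forall k z, V z -> Omega (phi k z)].
Proof.
case: cifs => _ _ _ _ oO maps [W [oW _ sub hol]] _.
exists [set z | W z /\ forall k, Omega (phi k z)]; split.
- rewrite openE => z [Oz Omz]; rewrite /interior.
  have h1 : nbhs z W by apply: open_nbhs_nbhs; split.
  have h2 : nbhs z [set w | forall k, Omega (phi k w)].
    apply: (@filter_forall _ _ (fun k w => Omega (phi k w)) (nbhs z)) => k.
    have [d d0 dO] := (open_cabsP _).1 oO _ (Omz k).
    have [r r0 rP] := derivable_ccont (hol k z Oz).1 d0.
    by apply/nbhs_cabsP; exists r => // w /rP/dO.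
  by apply: filterS (filterI h1 h2) => w [].
- by move=> z cz; split; [exact: sub|move=> k; apply: maps; exists z].
- by move=> k z [/(hol k)[]].
- by move=> k z [/(hol k)[]].
- by move=> k z [_ /(_ k)].
Qed.

(** All four bounds are written with one constant c and only weaken as c decreases, so a single
    compactness argument yields them together. *)
Lemma conformal_ifs_constants (V : set C) : open V -> closure Omega `<=` V ->
  (forall k, holo V (phi k)) -> (forall k z, V z -> 'D_1 (phi k) z != 0) ->
  (forall k z, V z -> Omega (phi k z)) ->
  exists rho kappa tau r : R,
  [/\ 0 <= rho < 1 /\
        (forall k z, closure Omega z -> cabs ('D_1 (phi k) z) <= rho),
      0 < kappa <= 1 /\
        (forall k z, closure Omega z -> kappa <= cabs ('D_1 (phi k) z)),
      0 <= tau /\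
        (forall k z, closure Omega z -> cabs (T_fin phi [:: k] z) <= tau) &
      0 < r /\ (forall k z, closure Omega z -> cball (phi k z) r `<=` Omega)].
Proof.
move=> oV sub hV nzV mapV; case: cifs => _ bO _ _ oO _ _ contr.
pose P (k : 'I_N) (c : R) := forall z, closure Omega z ->
  [/\ c <= cabs ('D_1 (phi k) z), cabs ('D_1 (phi k) z) <= 1 - c,
      c * cabs (T_fin phi [:: k] z) <= 1 & cball (phi k z) c `<=` Omega].
have [c c0 cP] : exists2 c, 0 < c & forall k, P k c.
  apply: fin_uniform => [k c c' c'c Pc z /Pc[h1 h2 h3 h4]|k].
    split; [lra|lra| |].
      by apply: le_trans h3; rewrite ler_wpM2r ?cabs_ge0.
    by move=> w wz; apply: h4; exact: lt_le_trans c'c.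
  apply: (@compact_uniform _ _ (fun c z =>
    [/\ c <= cabs ('D_1 (phi k) z), cabs ('D_1 (phi k) z) <= 1 - c,
      c * cabs (T_fin phi [:: k] z) <= 1 & cball (phi k z) c `<=` Omega])) => //.
    move=> c c' z c'c [h1 h2 h3 h4]; split; [lra|lra| |].
      by apply: le_trans h3; rewrite ler_wpM2r ?cabs_ge0.
    by move=> w wz; apply: h4; exact: lt_le_trans c'c.
  move=> z cz; have Vz := sub _ cz.
  have D0 : 0 < cabs ('D_1 (phi k) z) by rewrite cabs_gt0; exact: nzV.
  have D1 : cabs ('D_1 (phi k) z) < 1 by exact: contr.
  pose t := cabs (T_fin phi [:: k] z) + 1.
  have t0 : 0 < t by rewrite ltr_wpDl ?cabs_ge0.
  have [s s0 sO] := open_cball_sub oO (mapV k z Vz).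
  (* The halves leave room for the variation near z: |phi_k'| moves by at most c and phi_k by at
     most s / 2, while |T_k| stays below t. *)
  pose c := Num.min (Num.min (cabs ('D_1 (phi k) z) / 2) ((1 - cabs ('D_1 (phi k) z)) / 2))
    (Num.min t^-1 (s / 2)).
  have s2 : 0 < s / 2 by lra.
  have c0 : 0 < c by rewrite !lt_min invr_gt0 t0 s2 !divr_gt0//; lra.
  have [ca cb] : c <= cabs ('D_1 (phi k) z) / 2 /\ c <= (1 - cabs ('D_1 (phi k) z)) / 2.
    by split; rewrite /c !ge_min lexx ?orbT.
  have [cc cd] : c <= t^-1 /\ c <= s / 2.
    by split; rewrite /c !ge_min lexx ?orbT.
  have [r1 r10 r1P] := derivable_ccont (holo_derive oV (hV k) Vz) c0.
  have hT : holo V (T_fin phi [:: k]) by exact: holo_nonlinearity oV (hV k) (nzV k).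
  have [r2 r20 r2P] := derivable_ccont (hT _ Vz) (@ltr01 R).
  have [r3 r30 r3P] := derivable_ccont (hV k _ Vz) s2.
  exists c => //; exists (Num.min r1 (Num.min r2 r3)) => [|w cw].
    by rewrite !lt_min r10 r20.
  rewrite !lt_min => /and3P[/r1P h1 /r2P h2 /r3P h3]; split.
  - move: h1 ca {D0 D1 cb}; move: ('D_1 (phi k) w) ('D_1 (phi k) z) => x y h1 ca.
    by have := cabsD (y - x) x; rewrite subrK (cabsC y); lra.
  - move: h1 cb {D0 D1 ca}; move: ('D_1 (phi k) w) ('D_1 (phi k) z) => x y h1 cb.
    by have := cabsD (x - y) y; rewrite subrK; lra.
  - have tw : cabs (T_fin phi [:: k] w) <= t.
      move: h2; rewrite /t; move: (T_fin phi [:: k] w) (T_fin phi [:: k] z) => x y h2.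
      by have := cabsD (x - y) y; rewrite subrK; lra.
    apply: le_trans (ler_pM (ltW c0) (cabs_ge0 _) cc tw) _.
    by rewrite mulVf// lt0r_neq0.
  - move=> v vw; apply: sO; apply: cball_sub vw.
    by move: h3; lra.
exists (Num.max 0 (1 - c)), (Num.min 1 c), c^-1, c; split.
- split; first by rewrite le_max lexx gt_max ltr01 /=; lra.
  by move=> k z /(cP k)[_ h _ _]; rewrite le_max h orbT.
- split; first by rewrite lt_min ltr01 c0 ge_min lexx.
  by move=> k z /(cP k)[h _ _ _]; rewrite ge_min h orbT.
- split; first by rewrite invr_ge0 ltW.
  by move=> k z /(cP k)[_ _ h _]; rewrite -[c^-1]mulr1 ler_pdivlMl.
- by split=> // k z /(cP k)[].
Qed.

End Constants.

Theorem proposition5p9 (R : realType) (N : nat) (Omega : set (cplx R))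
    (phi : 'I_N -> cplx R -> cplx R) :
  conformal_ifs Omega phi ->
  (forall i j : word N, i <> j -> word_length i = word_length j ->
     0 < sup [set cabs (T_word Omega phi i x - T_word Omega phi j x)
             | x in closure Omega]) ->
  strong_exp_separation_mod_similarities Omega phi.
Proof.
move=> cifs sep.
have [V [oV sub hV nzV mapV]] := conformal_ifs_domain cifs.
have [rho [kappa [tau [r [[rho01 rhoP] [/andP[k0 k1] kP] [t0 tP] [r0 rP]]]]]] :=
  conformal_ifs_constants cifs oV sub hV nzV mapV.
case: (cifs) => N2 bO [p Op] cO oO _ _ _.
have Tsep (W W' : word N) : W <> W' -> word_length W = word_length W' ->
    exists2 z, closure Omega z & T_word Omega phi W z <> T_word Omega phi W' z.
  move=> WW' len; apply: contrapT => nz; have := sep W W' WW' len.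
  (* Equality on the whole closure would reduce the set to 0, as Omega is nonempty, and its supremum
     would not be positive. *)
  rewrite (_ : [set _ | _ in _] = [set 0]) ?sup1 ?ltxx//.
  apply/seteqP; split=> [_ [x cx <-]|_ ->] /=.
    apply/eqP; rewrite cabs_eq0 subr_eq0; apply/eqP; apply: contrapT => ne.
    by apply: nz; exists x.
  exists p; first exact: subset_closure.
  apply/eqP; rewrite cabs_eq0 subr_eq0; apply/eqP; apply: contrapT => ne.
  by apply: nz; exists p => //; exact: subset_closure.
have [c c0 cP] := exponential_separation oO oV sub hV nzV mapV rho01 rhoP k0 kP
  t0 tP bO cO r0 rP Tsep k1 (Ordinal (ltnW N2)) Op.
exists c => // n i j ij A simA.
rewrite (_ : [set _ | _ in _] = [set cabs (f_word phi (rev i) x -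
  A (f_word phi (rev j) x)) | x in closure Omega]); last first.
  by apply/seteqP; split=> _ [x cx <-]; exists x => //; rewrite !phi_word_rev.
(* Reversal is injective and preserves length, so the estimate for [f_word] passes to [phi_word]. *)
have := cP (rev i) (rev j) A; rewrite !size_rev !size_tuple; apply=> //.
by move=> /(can_inj revK) e; move/eqP: ij; apply; exact: val_inj.
Qed.
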